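(* The irreducible weight matrices $W_H$, $W_L$ and $W_J$ are not Darboux transformations of any direct sum of scalar weights $w_1\oplus\cdots\oplus w_N$.
   Context: Weight matrices are smooth, a.e. positive definite matrix functions on an interval with finite moments; $\langle P,Q\rangle_W=\int PWQ^*dx$; $(P_n)$ the monic orthogonal polynomials. Differential operators act on the right: $P\cdot\sum_j\partial^jF_j=\sum_j\partial^j(P)F_j$. The right Fourier algebra $\mathcal F_R(W)$ is the set of differential operators $\mathfrak D$ with matrix polynomial coefficients for which there exist finitely many sequences of constant matrices $A_j(n)$, $-\ell\le j\le k$, with $P_n\cdot\mathfrak D=\sum_{j=-\ell}^kA_j(n)P_{n+j}$ for all $n$. Given weights $W_1,W_2$ with monic orthogonal polynomials $P_n,Q_n$, $W_2$ is a Darboux transformation of $W_1$ if there exist $\mathfrak D,\widetilde{\mathfrak D}\in\mathcal F_R(W_1)$, matrix polynomials $F,\widetilde F$ invertible as rational matrix functions, and sequences of constant matrices $C_n,\widetilde C_n$ nonsingular for almost every $n$ with $C_nQ_n=P_n\cdot\mathfrak DF^{-1}$ and $\widetilde C_nP_n=Q_n\cdot\widetilde F^{-1}\widetilde{\mathfrak D}$. Classical scalar weights: Hermite $w_b(x)=e^{-x^2+2bx}$ on $\mathbb R$; Laguerre $w_\alpha(x)=e^{-x}x^\alpha$ on $(0,\infty)$, $\alpha>-1$; Jacobi $w_{\alpha,\beta}(x)=(1-x)^\alpha(1+x)^\beta$ on $(-1,1)$, $\alpha,\beta>-1$. Let $N\ge2$, $A=\sum_{j=1}^{\lfloor N/2\rfloor}a_{2j-1}E_{2j-1,2j}+\sum_{j=1}^{\lfloor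 (N-1)/2\rfloor}a_{2j}E_{2j+1,2j}$ ($E_{s,t}$ matrix units, all $a_j\in\mathbb R\setminus\{0\}$), $T(x)=I+Ax$. $W_H=T\,\mathrm{diag}(w_{b_1},\dots,w_{b_N})\,T^*$ with $b_i$ pairwise distinct reals; $W_L=T\,\mathrm{diag}(w_{\alpha_1},\dots,w_{\alpha_N})\,T^*$ with $\alpha_i-\alpha_j\notin\mathbb Z$ for $i\ne j$; $W_J=T\,\mathrm{diag}(w_{\alpha_1,\beta_1},\dots,w_{\alpha_N,\beta_N})\,T^*$ with, for $i\ne j$, $\alpha_i-\alpha_j\notin\mathbb Z$ or $\beta_i-\beta_j\notin\mathbb Z$, and $\alpha_1+\beta_1=\alpha_j+\beta_j+1+(-1)^j$ for all $j$. *)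

(* Defs.v *)
From HB Require Import structures.
From mathcomp Require Import all_boot all_order all_algebra.
From mathcomp Require Import complex.
From mathcomp Require Import all_classical all_reals all_analysis.

Set Implicit Arguments.
Unset Strict Implicit.
Unset Printing Implicit Defensive.

Import Order.TTheory GRing.Theory Num.Theory.
Local Open Scope ring_scope.
Local Open Scope classical_set_scope.

Section Defs.
Variable R : realType.
Local Notation C := (R[i]).
Local Notation mpoly N := ('M[{poly C}]_N).
Local Notation mrat N := ('M[{fraction {poly C}}]_N).
Local Notation "x %:F" := (@FracField.tofrac _ x).

Definition oitv (c d : \bar R) : set R := [set x : R | (c < x%:E < d)%E].

Definition reC (z : C) : R := complex.Re z.
Definition imC (z : C) : R := complex.Im z.
Definition RtoC (x : R) : C := (x%:C)%C.

Definition smooth_on (I : set R) (f : R -> R) : Prop :=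
  exists g : nat -> R -> R,
    (forall x, I x -> g 0%N x = f x) /\
    (forall k x, I x -> is_derive x (1 : R) (g k) (g k.+1 x)).

Definition posdef N (M : 'M[R]_N) : Prop :=
  M^T = M /\ forall v : 'rV[R]_N, v != 0 -> 0 < (v *m M *m v^T) ord0 ord0.

Definition weight_matrix N (c d : \bar R) (W : R -> 'M[R]_N) : Prop :=
  [/\ (c < d)%E,
      (forall i j, smooth_on (oitv c d) (fun x => W x i j)),
      {ae (@lebesgue_measure R), forall x, oitv c d x -> posdef (W x)} &
      (forall (k : nat) i j, (@lebesgue_measure R).-integrable (oitv c d)
          (fun x => (x ^+ k * W x i j)%:E))].

Definition scalar_weight (c d : \bar R) (w : R -> R) : Prop :=
  weight_matrix c d (fun x => (w x)%:M : 'M[R]_1).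

Definition direct_sum N (w : 'I_N -> R -> R) : R -> 'M[R]_N :=
  fun x => diag_mx (\row_i w i x).

Definition evalmp N (P : mpoly N) (x : R) : 'M[C]_N :=
  map_mx (fun p => p.[RtoC x]) P.

Definition adjC N (M : 'M[C]_N) : 'M[C]_N := (map_mx Num.conj M)^T.

Definition ip_zero N (c d : \bar R) (W : R -> 'M[R]_N) (P Q : mpoly N) : Prop :=
  forall i j,
    let f := fun x => (evalmp P x *m map_mx RtoC (W x) *m adjC (evalmp Q x)) i j in
    (\int[@lebesgue_measure R]_(x in oitv c d) (reC (f x))%:E = 0)%E /\
    (\int[@lebesgue_measure R]_(x in oitv c d) (imC (f x))%:E = 0)%E.

Definition monic_deg N (n : nat) (P : mpoly N) : Prop :=
  (forall i j, (size (P i j) <= n.+1)%N) /\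
  \matrix_(i, j) (P i j)`_n = 1%:M.

Definition monic_OPS N (c d : \bar R) (W : R -> 'M[R]_N) (P : nat -> mpoly N) : Prop :=
  (forall n, monic_deg n (P n)) /\
  (forall n m, n <> m -> ip_zero c d W (P n) (P m)).

(* A differential operator sum_j d^j F_j is given by its list of
   coefficients [F_0; F_1; ...]; it acts on the right:
   P . sum_j d^j F_j = sum_j (d^j P) F_j *)
Definition dop_act N (D : seq (mpoly N)) (P : mpoly N) : mpoly N :=
  \sum_(j < size D) map_mx (fun p => p^`(j)) P *m D`_j.

(* membership in the right Fourier algebra F_R(W), W having monic OPs P:
   P_n . D = sum_{j=-l}^{k} A_j(n) P_{n+j}  (with P_m = 0 for m < 0);
   here A i n stands for A_{i-l}(n). *)
Definition in_fourierR N (P : nat -> mpoly N) (D : seq (mpoly N)) : Prop :=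
  exists (l k : nat) (A : nat -> nat -> 'M[C]_N),
    forall n : nat,
      dop_act D (P n) =
      \sum_(i < l + k + 1)
         map_mx polyC (A i n) *m (if (l <= n + i)%N then P (n + i - l)%N else 0).

Definition torat N (P : mpoly N) : mrat N := map_mx (fun p => p%:F) P.

Definition deriv_frac (f : {fraction {poly C}}) : {fraction {poly C}} :=
  let r := repr f in
  let p := (fraction.frac r).1 in
  let q := (fraction.frac r).2 in
  (p^`() * q - p * q^`())%:F / (q ^+ 2)%:F.

Definition dop_act_rat N (D : seq (mpoly N)) (G : mrat N) : mrat N :=
  \sum_(j < size D) map_mx (iter j deriv_frac) G *m torat D`_j.

Definition darboux_seq N (P Q : nat -> mpoly N) : Prop :=
  exists (D Dt : seq (mpoly N)) (F Ft : mpoly N) (Cn Ctn : nat -> 'M[C]_N),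
    [/\ in_fourierR P D, in_fourierR P Dt,
        torat F \in unitmx & torat Ft \in unitmx] /\
    [/\ (exists n0, forall n, (n0 <= n)%N -> Cn n \in unitmx),
        (exists n0, forall n, (n0 <= n)%N -> Ctn n \in unitmx),
        (forall n, torat (map_mx polyC (Cn n) *m Q n)
                   = torat (dop_act D (P n)) *m invmx (torat F)) &
        (forall n, torat (map_mx polyC (Ctn n) *m P n)
                   = dop_act_rat Dt (torat (Q n) *m invmx (torat Ft)))].

Definition darboux_transformation N (c2 d2 : \bar R) (W2 : R -> 'M[R]_N)
    (c1 d1 : \bar R) (W1 : R -> 'M[R]_N) : Prop :=
  exists P Q : nat -> mpoly N,
    [/\ monic_OPS c1 d1 W1 P, monic_OPS c2 d2 W2 Q & darboux_seq P Q].

Definition darboux_of_scalar_sum N (c2 d2 : \bar R) (W2 : R -> 'M[R]_N) : Prop :=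
  exists (c1 d1 : \bar R) (w : 'I_N -> R -> R),
    (forall i, scalar_weight c1 d1 (w i)) /\
    darboux_transformation c2 d2 W2 c1 d1 (direct_sum w).

Definition Emx N (s t : nat) : 'M[R]_N :=
  \matrix_(i, j) ((i.+1 == s) && (j.+1 == t))%:R.

Definition Amx N (a : nat -> R) : 'M[R]_N :=
  \sum_(1 <= j < (N./2).+1) a (2 * j - 1)%N *: Emx N (2 * j - 1) (2 * j)
  + \sum_(1 <= j < (N.-1./2).+1) a (2 * j)%N *: Emx N (2 * j + 1) (2 * j).

Definition Tmx N (a : nat -> R) (x : R) : 'M[R]_N := 1%:M + x *: Amx N a.

Definition w_hermite (b x : R) : R := expR (- x ^+ 2 + 2 * b * x).
Definition w_laguerre (al x : R) : R := expR (- x) * powR x al.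
Definition w_jacobi (al be x : R) : R := powR (1 - x) al * powR (1 + x) be.

Definition W_of N (a : nat -> R) (w : 'I_N -> R -> R) (x : R) : 'M[R]_N :=
  Tmx N a x *m diag_mx (\row_i w i x) *m (Tmx N a x)^T.

Definition W_H N (a : nat -> R) (b : 'I_N -> R) :=
  W_of a (fun i => w_hermite (b i)).
Definition W_L N (a : nat -> R) (al : 'I_N -> R) :=
  W_of a (fun i => w_laguerre (al i)).
Definition W_J N (a : nat -> R) (al be : 'I_N -> R) :=
  W_of a (fun i => w_jacobi (al i) (be i)).

End Defs.

(* Main.v *)
Require Import Defs.
From HB Require Import structures.
From mathcomp Require Import all_boot all_order all_algebra.
From mathcomp Require Import complex.
From mathcomp Require Import all_classical all_reals all_analysis.
From mathcomp Require Import measurable_realfun.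
From mathcomp Require Import ring lra zify.
Import Order.TTheory GRing.Theory Num.Theory.
Import numFieldNormedType.Exports.
Local Open Scope ring_scope.

(** Replace every scalar weight by its moment functional on [C[x]].  If [W] (with
    orthogonal polynomials [Q_n]) is a Darboux transformation of a direct sum with
    functionals [L_b] (orthogonal polynomials [P_n]), then
    [C_n Q_n F = P_n . D] is orthogonal to all low degrees, so the functional
    [P |-> int P F W1] vanishes on [Q_n] for large [n] and hence equals
    [P |-> int P W Y] for a matrix polynomial [Y].  With [W = T diag(w_i) T^*] this
    reads [B_ib L_b = Y'_ib M_i], where [B = T^-1 F] and [M_i] is the functional of
    [w_i].  The [M_i] satisfy Pearson equations and are independent over [C[x]], so
    [B] is a monomial matrix, and integrating by parts the off-diagonal entries of
    [D] act as zero.  Consequently some row of [C_n Q_n T] is [s e_2] with a scalar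
    polynomial [s]; since [e_2 T = e_2] the degree of [s] is at most [n], while
    orthogonality to [e_2 T] and [e_1 T] (whose second entry is [a_1 x]) makes [s]
    orthogonal to all degrees at most [n].  Hence [s = 0], contradicting the
    invertibility of [C_n]. *)

Set Implicit Arguments.
Unset Strict Implicit.
Unset Printing Implicit Defensive.

(** * Linear functionals satisfying a Pearson equation *)

Section Functionals.
Variable C : numClosedFieldType.
Implicit Types (p q f g u tau : {poly C}) (M L : {scalar {poly C}}).

(** On the real line [conjp p] takes the conjugate values of [p], so for a real weight
    [M (p * conjp q)] is a hermitian pairing while [M] itself stays linear. *)
Definition conjp p := map_poly (@Num.conj C) p.

Lemma conjpK : involutive conjp.
Proof. by move=> p; apply/polyP => i; rewrite !coef_map /= conjCK. Qed.

Lemma conjpD p q : conjp (p + q) = conjp p + conjp q.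
Proof. exact: rmorphD. Qed.

Lemma conjpM p q : conjp (p * q) = conjp p * conjp q.
Proof. exact: rmorphM. Qed.

Lemma conjpC c : conjp c%:P = (c^* )%:P.
Proof. exact: map_polyC. Qed.

Lemma conjp0 : conjp 0 = 0.
Proof. exact: rmorph0. Qed.

Lemma size_conjp p : size (conjp p) = size p.
Proof. exact: size_map_poly. Qed.

Definition pos_fun (M : {poly C} -> C) := forall p, p != 0 -> 0 < M (p * conjp p).

Lemma pos_fun_eq0 M p : pos_fun M -> M (p * conjp p) = 0 -> p = 0.
Proof.
move=> posM Mp0; apply/eqP; apply: contraT => /posM.
by rewrite Mp0 ltxx.
Qed.

Lemma pos_fun_ge0 M p : pos_fun M -> 0 <= M (p * conjp p).
Proof.
move=> posM; have [->|/posM/ltW//] := eqVneq p 0.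
by rewrite mul0r linear0.
Qed.

(* The functional is the moment functional of a weight [w] such that
   [(u w)' = tau w]. *)
Definition pearson u tau M := forall q, M (u * q^`() + tau * q) = 0.

Lemma pearson_parts u tau M f q : pearson u tau M ->
  M (u * f * q^`()) = - M ((tau * f + u * f^`()) * q).
Proof.
move=> /(_ (f * q)); rewrite derivM => h.
apply/eqP; rewrite -addr_eq0 -linearD -[X in _ == X]h; apply/eqP.
by congr (M _); ring.
Qed.

(** Each integration by parts spends one factor [u]: [u] times the derivative of [u ^+ k * f] is
    again divisible by [u ^+ k], so the power lasts for all the derivatives. *)
Lemma pearson_parts_iter u tau M : pearson u tau M ->
  forall k f, exists g, forall q, M (u ^+ k * f * q^`(k)) = M (g * q).
Proof.
move=> hM; elim=> [|k IH] f; first by exists f => q; rewrite mul1r.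
have [g hg] := IH (- (tau * f + u^`() * f *+ k + u * f^`())).
exists g => q; rewrite -hg derivnS exprS -(mulrA u) (pearson_parts _ _ hM) -linearN.
congr (M _); rewrite -mulNr mulrN; congr (- _ * _).
rewrite derivM deriv_exp; case: k {IH hg} => [|k] /=.
  by rewrite !mulr0n !expr0; ring.
by rewrite exprS; ring.
Qed.

Lemma pearson_parts_sum u tau M (D : nat -> {poly C}) n f : pearson u tau M ->
  exists g, forall q,
    M (u ^+ n * f * \sum_(j < n) q^`(j) * D j) = M (g * q).
Proof.
(* The induction adds terms one by one while the power [u ^+ n] stays fixed; the term of order [m]
   spends [u ^+ m] and leaves the rest in the cofactor. *)
move=> hM; suff: forall m, (m <= n)%N -> exists g, forall q,
    M (u ^+ n * f * \sum_(j < m) q^`(j) * D j) = M (g * q) by exact.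
elim=> [|m IH] lemn.
  by exists 0 => q; rewrite big_ord0 mulr0 mul0r.
have [g1 h1] := IH (ltnW lemn).
have [g2 h2] := pearson_parts_iter hM m (u ^+ (n - m) * f * D m).
exists (g1 + g2) => q; rewrite big_ord_recr /= mulrDr mulrDl !linearD /= h1 -h2.
congr (_ + M _); rewrite -{1}(subnKC (ltnW lemn)) exprD; ring.
Qed.

(* [f w1 = g w2] forces [g / f] to have logarithmic derivative
   [(tau1 - tau2) / u]. *)
Lemma pearson_wronskian u tau1 tau2 M1 M2 f g : pos_fun M1 ->
  pearson u tau1 M1 -> pearson u tau2 M2 ->
  (forall q, M1 (f * q) = M2 (g * q)) ->
  (tau1 - tau2) * (f * g) = u * (f * g^`() - f^`() * g).
Proof.
move=> pos1 hM1 hM2 hfg.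
(* Testing [f w1 = g w2] on multiples of [u] times a derivative and integrating by parts yields the
   differentiated relation. *)
have hd q : M1 ((tau1 * f + u * f^`()) * q) = M2 ((tau2 * g + u * g^`()) * q).
  apply: oppr_inj; rewrite -(pearson_parts _ _ hM1) -(pearson_parts _ _ hM2).
  by rewrite -mulrA mulrCA hfg mulrCA mulrA.
suff /eqP : g * (tau1 * f + u * f^`()) - f * (tau2 * g + u * g^`()) = 0.
  rewrite subr_eq0 => /eqP h; apply/eqP; rewrite -subr_eq0; apply/eqP.
  transitivity (g * (tau1 * f + u * f^`()) - f * (tau2 * g + u * g^`())).
    ring.
  by rewrite h subrr.
(* The first product in [k] moves to [M2] by [hd], the second by [hfg]; there they coincide, so [k]
   has norm zero. *)
apply: (pos_fun_eq0 pos1); set k := _ - _.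
rewrite /k mulrBl linearB /= -!mulrA mulrCA hd hfg.
by apply/eqP; rewrite subr_eq0; apply/eqP; congr (M2 _); ring.
Qed.

Definition indep_fun M1 M2 := forall f g,
  (forall q, M1 (f * q) = M2 (g * q)) -> f = 0.

Lemma indep_funI M1 M2 : pos_fun M1 -> pos_fun M2 ->
  (forall f g, f != 0 -> g != 0 -> ~ (forall q, M1 (f * q) = M2 (g * q))) ->
  indep_fun M1 M2.
Proof.
move=> pos1 pos2 h f g hfg; apply/eqP; apply: contraT => f0.
have g0 : g != 0.
  apply: contraNneq f0 => g0; apply/eqP; apply: (pos_fun_eq0 pos1).
  by rewrite hfg g0 mul0r linear0.
by case: (h f g f0 g0).
Qed.

(** By degrees: both halves of the Wronskian have lower degree than [f * g]. This settles the
    Hermite case, where [u] is 1 and [tau1 - tau2] is constant. *)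
Lemma wronskian_const f g c : f != 0 -> g != 0 ->
  c%:P * (f * g) = f * g^`() - f^`() * g -> c = 0.
Proof.
move=> f0 g0 h; apply/eqP; apply: contraT => c0.
have : (size (c%:P * (f * g))%R < size (f * g)%R)%N.
  rewrite h (leq_ltn_trans (size_polyD _ _))// size_polyN gtn_max.
  have lt1 (a b : {poly C}) : a != 0 -> b != 0 ->
      (size (a * b^`())%R < size (a * b)%R)%N.
    move=> a0 b0; have [->|db0] := eqVneq b^`() 0.
      by rewrite mulr0 size_poly0 size_poly_gt0 mulf_neq0.
    by rewrite !size_mul// (polySpred a0) !addSn ltn_add2l lt_size_deriv.
  by rewrite lt1//= [f^`() * g]mulrC [f * g]mulrC lt1.
by rewrite mul_polyC size_scale// ltnn.
Qed.

(* [z] is the difference of the orders of vanishing of [g] and [f] at [a]. *)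
Lemma wronskian_root f g u delta a : f != 0 -> g != 0 ->
  delta * (f * g) = ('X - a%:P) * u * (f * g^`() - f^`() * g) ->
  exists z : int, delta.[a] = u.[a] * z%:~R.
Proof.
move=> f0 g0.
have [m [f1 rf1 ->]] := multiplicity_XsubC f a; rewrite f0 /= in rf1.
have [n [g1 rg1 ->]] := multiplicity_XsubC g a; rewrite g0 /= in rg1.
set Y := 'X - a%:P => h.
have Y0 : Y != 0 by rewrite polyXsubC_eq0.
have dY k : Y * (Y ^+ k)^`() = Y ^+ k *+ k.
  rewrite deriv_exp derivXsubC mul1r mulrnAr; case: k => [|k] /=.
    by rewrite !mulr0n.
  by rewrite exprS.
(* Multiplication by [Y] turns the derivative of [Y ^+ n] into [n] times [Y ^+ n]. Both sides then
   carry [Y ^+ (m + n)], which is cancelled before evaluating at [a]. *)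
have h2 : delta * (f1 * g1) * Y ^+ (m + n) =
   u * ((f1 * g1) * (n%:R - m%:R) + Y * (f1 * g1^`() - f1^`() * g1))
     * Y ^+ (m + n).
  rewrite exprD.
  transitivity (delta * (f1 * Y ^+ m * (g1 * Y ^+ n))); first by ring.
  rewrite h !derivM.
  transitivity (u * (f1 * Y ^+ m * (Y * g1^`() * Y ^+ n + g1 * (Y * (Y ^+ n)^`()))
     - (Y * f1^`() * Y ^+ m + f1 * (Y * (Y ^+ m)^`())) * (g1 * Y ^+ n))).
    ring.
  by rewrite !dY; ring.
move/(mulIf (expf_neq0 _ Y0)): h2 => /(congr1 (horner^~ a)).
rewrite !(hornerM, hornerD, hornerN, hornerMn, hornerX, hornerC) subrr.
rewrite mul0r addr0 => h2; exists (n%:Z - m%:Z).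
apply: (@mulIf _ (f1.[a] * g1.[a])); first by rewrite mulf_neq0.
by rewrite h2 rmorphB /= -!pmulrn; ring.
Qed.

End Functionals.

(** * Orthogonal sequences of matrix polynomials *)

Section Rows.
Variables (C : numClosedFieldType) (N : nat).
Local Notation rpoly := 'rV[{poly C}]_N.
Local Notation mpoly := 'M[{poly C}]_N.
Local Notation lift := (map_mx polyC).
Implicit Types (M L : 'I_N -> {scalar {poly C}}) (r s : rpoly) (v : 'rV[C]_N).
Implicit Types (P Q : nat -> mpoly).

Definition rform M r s : C := \sum_k M k (r 0 k * conjp (s 0 k)).

Lemma rformDl M r1 r2 s : rform M (r1 + r2) s = rform M r1 s + rform M r2 s.
Proof.
by rewrite -big_split; apply: eq_bigr => k _; rewrite mxE mulrDl linearD.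
Qed.

Lemma rformZl M c r s : rform M (c%:P *: r) s = c * rform M r s.
Proof.
rewrite mulr_sumr; apply: eq_bigr => k _.
by rewrite mxE -mulrA mul_polyC linearZ.
Qed.

Lemma rformDr M r s1 s2 : rform M r (s1 + s2) = rform M r s1 + rform M r s2.
Proof.
by rewrite -big_split; apply: eq_bigr => k _;
  rewrite mxE conjpD mulrDr linearD.
Qed.

Lemma rformZr M c r s : rform M r (c%:P *: s) = c^* * rform M r s.
Proof.
rewrite mulr_sumr; apply: eq_bigr => k _.
by rewrite mxE conjpM conjpC mulrCA mul_polyC linearZ.
Qed.

Lemma rform0l M s : rform M 0 s = 0.
Proof. by rewrite -[0 in LHS](scale0r 0) -[0 in LHS]polyC0 rformZl mul0r. Qed.

Lemma rform0r M r : rform M r 0 = 0.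
Proof.
by rewrite -[0 in LHS](scale0r 0) -[0 in LHS]polyC0 rformZr conjC0 mul0r.
Qed.

Lemma lift_mul_row v n (A : 'M[{poly C}]_(N, n)) :
  lift v *m A = \sum_i (v 0 i)%:P *: row i A.
Proof. by rewrite mulmx_sum_row; apply: eq_bigr => i _; rewrite mxE. Qed.

Lemma rform_lift_l M v (A : mpoly) s :
  rform M (lift v *m A) s = \sum_i v 0 i * rform M (row i A) s.
Proof.
rewrite lift_mul_row (big_morph (rform M ^~ s) (id1 := 0) (op1 := +%R)).
- by apply: eq_bigr => i _; rewrite rformZl.
- by move=> *; rewrite rformDl.
- exact: rform0l.
Qed.

Lemma rform_lift_r M v (A : mpoly) r :
  rform M r (lift v *m A) = \sum_i (v 0 i)^* * rform M r (row i A).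
Proof.
rewrite lift_mul_row (big_morph (rform M r) (id1 := 0) (op1 := +%R)).
- by apply: eq_bigr => i _; rewrite rformZr.
- by move=> *; rewrite rformDr.
- exact: rform0r.
Qed.

Lemma rform_eq0 M r : (forall i, pos_fun (M i)) -> rform M r r = 0 -> r = 0.
Proof.
move=> posM /psumr_eq0P h; apply/rowP => k; rewrite mxE.
by apply: (pos_fun_eq0 (posM k)); apply: h => // i _; apply: pos_fun_ge0.
Qed.

Definition monic_mx n (A : mpoly) :=
  (forall i j, (size (A i j) <= n.+1)%N) /\ \matrix_(i, j) (A i j)`_n = 1%:M.

Lemma coef_lift_mul v (A : mpoly) (j : 'I_N) k :
  ((lift v *m A) 0 j)`_k = \sum_i v 0 i * (A i j)`_k.
Proof. by rewrite mxE coef_sum; apply: eq_bigr => i _; rewrite mxE coefCM. Qed.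

Lemma coef_lift_monic n v (A : mpoly) (j : 'I_N) : monic_mx n A ->
  ((lift v *m A) 0 j)`_n = v 0 j.
Proof.
case=> _ /matrixP hA; rewrite coef_lift_mul (bigD1 j)//= big1 => [|i ij].
  by have := hA j j; rewrite !mxE eqxx => ->; rewrite mulr1 addr0.
by have := hA i j; rewrite !mxE (negbTE ij) => ->; rewrite mulr0.
Qed.

Lemma size_lift_monic n v (A : mpoly) (j : 'I_N) : monic_mx n A ->
  (size ((lift v *m A) 0 j)%R <= n.+1)%N.
Proof.
case=> hA _; apply/leq_sizeP => k nk; rewrite coef_lift_mul big1// => i _.
by rewrite nth_default ?mulr0// (leq_trans (hA i j)).
Qed.

Lemma lift_monic_eq0 n v (A : mpoly) : monic_mx n A -> lift v *m A = 0 -> v = 0.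
Proof.
move=> hA h0; apply/rowP => j.
by rewrite -(coef_lift_monic v j hA) h0 !mxE coef0.
Qed.

(** Rows of degree below [n] are constant combinations of rows of [Q 0], ..., [Q (n - 1)]: monicity
    allows the top coefficients to be subtracted as [lift v *m Q n]. *)
Lemma monic_row_ind Q (X : rpoly -> Prop) n : (forall m, monic_mx m (Q m)) ->
  X 0 -> (forall r s, X r -> X s -> X (r + s)) ->
  (forall m v, (m < n)%N -> X (lift v *m Q m)) ->
  forall r, (forall j, (size (r 0 j)%R <= n)%N) -> X r.
Proof.
move=> hQ X0 XD; elim: n => [|n IH] XQ r hr.
  rewrite (_ : r = 0)//; apply/rowP => j; rewrite mxE; apply/eqP.
  by rewrite -size_poly_leq0.
set v := \row_j (r 0 j)`_n.
rewrite -(subrK (lift v *m Q n) r); apply: (XD); last exact: XQ.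
apply: IH => [m w mn|j]; first by apply: XQ; rewrite ltnW.
have -> : (r - lift v *m Q n) 0 j = r 0 j - (lift v *m Q n) 0 j.
  by rewrite mxE; congr (_ + _); rewrite mxE.
apply/leq_sizeP => k; rewrite leq_eqVlt coefB => /predU1P[<-|nk].
  by rewrite coef_lift_monic// mxE subrr.
by rewrite !nth_default ?subrr// (leq_trans _ nk) ?size_lift_monic.
Qed.

(** * Orthogonality for the weight T diag(M) T^*, expressed by multiplying rows by T *)

Section Orthogonal.
Variables (M : 'I_N -> {scalar {poly C}}) (T : mpoly) (Q : nat -> mpoly).
Hypothesis monicQ : forall n, monic_mx n (Q n).
Hypothesis orthQ : forall n m i j, n <> m ->
  rform M (row i (Q n *m T)) (row j (Q m *m T)) = 0.

Lemma orth_lower n i r : (forall j, (size (r 0 j)%R <= n)%N) ->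
  rform M (row i (Q n *m T)) (r *m T) = 0.
Proof.
apply: (@monic_row_ind Q (fun r => rform M (row i (Q n *m T)) (r *m T) = 0) n) => //.
- by rewrite mul0mx rform0r.
- by move=> r1 r2 h1 h2; rewrite mulmxDl rformDr h1 h2 addr0.
- move=> m v mn; rewrite -mulmxA rform_lift_r big1// => k _.
  by rewrite orthQ ?mulr0// => nm; rewrite nm ltnn in mn.
Qed.

Hypothesis posM : forall i, pos_fun (M i).
Variable T' : mpoly.
Hypothesis TT' : T *m T' = 1%:M.

Definition gram n : 'M[C]_N :=
  \matrix_(i, j) rform M (row i (Q n *m T)) (row j (Q n *m T)).

(** A left kernel vector gives a combination of the rows of [Q n *m T] of norm zero; positivity,
    invertibility of [T] and monicity make the vector zero. *)
Lemma gram_unit n : gram n \in unitmx.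
Proof.
rewrite -row_free_unit; apply: inj_row_free => z zS.
have h j : rform M (lift z *m (Q n *m T)) (row j (Q n *m T)) = 0.
  rewrite rform_lift_l; move/rowP: zS => /(_ j); rewrite !mxE => {2}<-.
  by apply: eq_bigr => i _; rewrite mxE.
have : lift z *m (Q n *m T) = 0.
  apply: (rform_eq0 posM); rewrite rform_lift_r big1// => i _.
  by rewrite h mulr0.
rewrite mulmxA => /(congr1 (fun r => r *m T')).
rewrite -[X in X = _]mulmxA TT' mulmx1 mul0mx; exact: lift_monic_eq0.
Qed.

(** Induction on [n0]: subtracting from [F] the pairing with a suitable combination of the rows of
    [Q n0] makes it vanish on [Q n0] too. A functional vanishing on every [Q n] is zero. *)
Lemma row_functional_repr (F : rpoly -> C) n0 :
  {morph F : r s / r + s} -> (forall c r, F (c%:P *: r) = c * F r) ->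
  (forall n i, (n0 <= n)%N -> F (row i (Q n)) = 0) ->
  exists Y : 'I_N -> {poly C}, forall r, F r = \sum_k M k ((r *m T) 0 k * Y k).
Proof.
elim: n0 F => [|n0 IH] F FD FZ F0.
  exists (fun=> 0) => r; rewrite big1 => [|k _]; last by rewrite mulr0 linear0.
  have F00 : F 0 = 0 by apply: (addrI (F 0)); rewrite -FD !addr0.
  apply: (@monic_row_ind Q (fun r => F r = 0) (\max_j size (r 0 j)%R)%N) => //.
  - by move=> r1 r2 h1 h2; rewrite FD h1 h2 addr0.
  - move=> m v _; rewrite lift_mul_row (big_morph F FD F00) big1// => i _.
    by rewrite FZ F0// mulr0.
  - by move=> j; rewrite (leq_bigmax (F := fun j => size (r 0 j))).
(* [w] solves the Gram system for the values of [F] on the rows of [Q n0]; it is conjugated in [v]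
   because the pairing is conjugate linear on the right. *)
pose w := invmx (gram n0) *m \col_i F (row i (Q n0)).
pose v := \row_j (w j 0)^*.
pose G r := F r - rform M (r *m T) (lift v *m (Q n0 *m T)).
have [||n i n0n|Y hY] := IH G.
- by move=> r s; rewrite /G FD mulmxDl rformDl; ring.
- by move=> c r; rewrite /G FZ -scalemxAl rformZl; ring.
- rewrite /G -row_mul rform_lift_r.
  move: n0n; rewrite leq_eqVlt => /predU1P[<-|n0n]; last first.
    rewrite F0// big1 ?subrr// => j _; rewrite orthQ ?mulr0//.
    by move=> nn; rewrite nn ltnn in n0n.
  have /colP/(_ i) : gram n0 *m w = \col_i F (row i (Q n0)).
    by rewrite mulmxA mulmxV ?gram_unit// mul1mx.
  rewrite !mxE => <-; apply/eqP; rewrite subr_eq0; apply/eqP.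
  by apply: eq_bigr => j _; rewrite !mxE conjCK mulrC.
exists (fun k => Y k + conjp ((lift v *m (Q n0 *m T)) 0 k)) => r.
transitivity (G r + rform M (r *m T) (lift v *m (Q n0 *m T))).
  by rewrite subrK.
rewrite hY -big_split; apply: eq_bigr => k _ /=.
by rewrite mulrDr linearD.
Qed.

End Orthogonal.
End Rows.

(** * The algebraic obstruction *)

Section Core.
Variables (C : numClosedFieldType) (N : nat).
Local Notation rpoly := 'rV[{poly C}]_N.
Local Notation mpoly := 'M[{poly C}]_N.
Local Notation lift := (map_mx polyC).

(** This is [dop_act] for any number of rows, so that the operator can be applied to a single
    row. *)
Definition dact (D : seq mpoly) m (A : 'M[{poly C}]_(m, N)) : 'M[{poly C}]_(m, N) :=
  \sum_(j < size D) map_mx (fun p => p^`(j)) A *m D`_j.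

Lemma row_dact D m (A : 'M[{poly C}]_(m, N)) i :
  row i (dact D A) = dact D (row i A).
Proof.
by rewrite linear_sum; apply: eq_bigr => j _; rewrite /= row_mul map_row.
Qed.

Lemma dactD D m : {morph @dact D m : A B / A + B}.
Proof.
move=> A B; rewrite -big_split; apply: eq_bigr => j _ /=.
by rewrite -mulmxDl; congr (_ *m _); apply/matrixP => i k; rewrite !mxE derivnD.
Qed.

Lemma dactZ D m c (A : 'M[{poly C}]_(m, N)) : dact D (c%:P *: A) = c%:P *: dact D A.
Proof.
rewrite scaler_sumr; apply: eq_bigr => j _; rewrite scalemxAl.
by congr (_ *m _); apply/matrixP => i k; rewrite !mxE !mul_polyC derivnZ.
Qed.

Lemma dact_delta D p (a b : 'I_N) :
  (dact D (p *: delta_mx (0 : 'I_1) a)) 0 b =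
  \sum_(j < size D) p^`(j) * (D`_j : mpoly) a b.
Proof.
rewrite summxE; apply: eq_bigr => j _; rewrite mxE (bigD1 a)//= big1 => [|i ia].
  by rewrite !mxE !eqxx mulr1 addr0.
by rewrite !mxE (negbTE ia) andbF mulr0 linear0 mul0r.
Qed.

Lemma rform_delta (L : 'I_N -> {scalar {poly C}}) r p b :
  rform L r (p *: delta_mx 0 b) = L b (r 0 b * conjp p).
Proof.
rewrite /rform (bigD1 b)//= big1 => [|i ib].
  by rewrite !mxE !eqxx mulr1 addr0.
by rewrite !mxE (negbTE ib) andbF mulr0 conjp0 mulr0 linear0.
Qed.

Lemma size_delta n (p : {poly C}) (b j : 'I_N) : (size p <= n)%N ->
  (size ((p *: delta_mx (0 : 'I_1) b) 0 j)%R <= n)%N.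
Proof.
move=> hp; rewrite !mxE eqxx /=; case: eqP => _; first by rewrite mulr1.
by rewrite mulr0 size_poly0.
Qed.

(** * Algebraic setting: the weight T diag(M) T^* obtained from diag(L) *)

Variables (M L : 'I_N -> {scalar {poly C}}) (T T' F : mpoly).
Variables (P Q : nat -> mpoly) (D : seq mpoly) (Cn : nat -> 'M[C]_N).
Variables (u : {poly C}) (tau : 'I_N -> {poly C}) (i0 i1 : 'I_N) (a : C).
Variables (l n0 : nat).
Hypothesis posM : forall i, pos_fun (M i).
Hypothesis posL : forall i, pos_fun (L i).
Hypothesis TT' : T *m T' = 1%:M.
Hypothesis T'_i0 : row i0 T' = delta_mx 0 i0.
Hypothesis T_i0 : T i0 i0 = 1.
Hypothesis T_i1 : T i1 i0 = a%:P * 'X.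
Hypothesis a_neq0 : a != 0.
Hypothesis monicP : forall n, monic_mx n (P n).
Hypothesis monicQ : forall n, monic_mx n (Q n).
Hypothesis orthP : forall n m i j, n <> m ->
  rform L (row i (P n)) (row j (P m)) = 0.
Hypothesis orthQ : forall n m i j, n <> m ->
  rform M (row i (Q n *m T)) (row j (Q m *m T)) = 0.
Hypothesis u_neq0 : u != 0.
Hypothesis pearsonM : forall i, pearson u (tau i) (M i).
Hypothesis indepM : forall i j, i != j -> indep_fun (M i) (M j).
Hypothesis detF : \det F != 0.
Hypothesis fourierD : forall n m i j, (m + l < n)%N ->
  rform L (row i (dact D (P n))) (row j (P m)) = 0.
Hypothesis CQF : forall n, lift (Cn n) *m Q n *m F = dact D (P n).
Hypothesis unitC : forall n, (n0 <= n)%N -> Cn n \in unitmx.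

Let orthP1 n m i j : n <> m ->
  rform L (row i (P n *m 1%:M)) (row j (P m *m 1%:M)) = 0.
Proof. by rewrite !mulmx1; exact: orthP. Qed.

(** By [fourierD] the rows of [P n . D] are orthogonal to [P m] for [m + l < n], and these span the
    rows of degree below [n - l]. *)
Lemma dact_orth n i (r : rpoly) : (forall j, (size (r 0 j)%R + l <= n)%N) ->
  rform L (row i (dact D (P n))) r = 0.
Proof.
move=> hr.
apply: (@monic_row_ind _ _ P (fun r => rform L (row i (dact D (P n))) r = 0)
  (n - l) monicP) => [||m v mn|j].
- exact: rform0r.
- by move=> r1 r2 h1 h2; rewrite rformDr h1 h2 addr0.
- rewrite rform_lift_r big1// => k _; rewrite fourierD ?mulr0//.
  by rewrite addnC -ltn_subRL.
- by rewrite leq_subRL ?(leq_trans (leq_addl _ _) (hr j))// addnC.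
Qed.

Lemma dact_orth_entry n i b (p : {poly C}) : (size p + l <= n)%N ->
  L b ((dact D (P n)) i b * p) = 0.
Proof.
move=> hp; have := @dact_orth n i (conjp p *: delta_mx 0 b).
rewrite rform_delta conjpK mxE; apply => j.
by apply: leq_trans hp; rewrite leq_add2r size_delta// size_conjp.
Qed.

(** By monicity an off-diagonal entry has degree below [n], so row [i] of [P n] is orthogonal to
    that entry placed alone in column [b]; this pairing is the squared norm of the entry. *)
Lemma P_diag n i b : i != b -> P n i b = 0.
Proof.
move=> ib; apply: (pos_fun_eq0 (posL b)).
have -> : P n i b * conjp (P n i b) = row i (P n) 0 b * conjp (P n i b).
  by rewrite mxE.
rewrite -rform_delta -(mulmx1 (P n)) -[_ *: _]mulmx1.
apply: (orth_lower monicP orthP1) => j; apply: size_delta; rewrite mulmx1.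
have [hs /matrixP/(_ i b)] := monicP n; rewrite !mxE (negbTE ib) => h0.
apply/leq_sizeP => k; rewrite leq_eqVlt => /predU1P[<-//|nk].
by rewrite nth_default// (leq_trans (hs i b)).
Qed.

Definition reduced_mx := T' *m F.
Local Notation B := reduced_mx.

(** The functional taking [r] to [L b] of entry [b] of [r *m F] vanishes on [Q n] for large [n],
    since [Cn n] is invertible and [P n . D] is orthogonal to constants. *)
Lemma FW_entry b : exists Y : 'I_N -> {poly C}, forall i p,
  L b (B i b * p) = M i (Y i * p).
Proof.
(* The threshold combines invertibility of [Cn n], from [n0] on, with orthogonality to the
   polynomial 1, which has size 1 and so needs [l.+1]. *)
have [|||Y hY] := @row_functional_repr _ _ M T Q monicQ orthQ posM T' TT'
  (fun r => L b ((r *m F) 0 b)) (maxn n0 l.+1).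
- by move=> r s; rewrite mulmxDl mxE linearD.
- by move=> c r; rewrite -scalemxAl mxE mul_polyC linearZ.
- move=> n i; rewrite geq_max => /andP[n0n ln].
  suff : Cn n *m \col_i L b ((Q n *m F) i b) = 0.
    move=> /(congr1 (mulmx (invmx (Cn n)))).
    rewrite mulmxA mulVmx ?unitC// mul1mx mulmx0 => /colP/(_ i) h.
    by rewrite -row_mul mxE; move: h; rewrite !mxE.
  apply/colP => k; rewrite !mxE.
  have := @dact_orth_entry n k b 1; rewrite size_poly1 add1n ln mulr1 -CQF.
  move=> /(_ isT) h; rewrite -[RHS]h.
  rewrite -mulmxA [in RHS]mxE linear_sum. apply: eq_bigr => j _.
  by rewrite !mxE mul_polyC linearZ.
(* A multiple of row [i] of [T'] becomes a multiple of a unit row after multiplication by [T], which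
   leaves only [M i]. *)
exists Y => i p; transitivity (L b ((p *: row i T' *m F) 0 b)).
  rewrite -scalemxAl -row_mul; congr (L b _).
  by rewrite [RHS]mxE [X in _ = _ * X]mxE mulrC.
rewrite hY -scalemxAl -row_mul (mulmx1C TT') row1 (bigD1 i)//= big1 => [|j ji].
  by rewrite !mxE !eqxx mulr1 addr0 mulrC.
by rewrite !mxE (negbTE ji) andbF mulr0 mul0r linear0.
Qed.

Lemma FW_entry_neq0 b Y i : (forall p, L b (B i b * p) = M i (Y * p)) ->
  B i b != 0 -> Y != 0.
Proof.
move=> hY; apply: contraNneq => Y0; apply/eqP/(pos_fun_eq0 (posL b)).
by rewrite hY Y0 mul0r linear0.
Qed.

(** With two nonzero entries in one column, eliminating [L b] gives a polynomial relation between
    [M i] and [M i'], contrary to independence. *)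
Lemma reduced_mx_col i i' b : B i b != 0 -> B i' b != 0 -> i = i'.
Proof.
have [Y hY] := FW_entry b; move=> Bi Bi'; apply/eqP; apply: contraT => ii'.
have /eqP : B i' b * Y i = 0.
  apply: (indepM ii' (g := B i b * Y i')) => q.
  transitivity (M i (Y i * (B i' b * q))); first by congr (M i _); ring.
  rewrite -hY; transitivity (L b (B i' b * (B i b * q))).
    by congr (L b _); ring.
  by rewrite hY; congr (M i' _); ring.
by rewrite mulf_eq0 (negbTE Bi') (negbTE (FW_entry_neq0 (hY i) Bi)).
Qed.

Lemma det_reduced_mx : \det B != 0.
Proof.
rewrite det_mulmx mulf_neq0//; apply/eqP => dT'.
have /eqP := congr1 (fun A => \det A) TT'.
by rewrite det_mulmx dT' mulr0 det1 eq_sym oner_eq0.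
Qed.

(** Columns [b] and [b'] would both be supported in row [i] alone, hence proportional; the kernel
    vector [c] then contradicts the nonzero determinant. *)
Lemma reduced_mx_row i b b' : B i b != 0 -> B i b' != 0 -> b = b'.
Proof.
move=> Bb Bb'; apply/eqP; apply: contraT => bb'.
pose c : 'cV[{poly C}]_N := B i b' *: delta_mx b 0 - B i b *: delta_mx b' 0.
have Bc : B *m c = 0.
  apply/colP => k.
  have -> : (B *m c) k 0 = B i b' * B k b - B i b * B k b'.
    by rewrite mulmxBr -!scalemxAr -!colE !mxE.
  rewrite [RHS]mxE; have [->|ki] := eqVneq k i; first by rewrite mulrC subrr.
  have z d : B i d != 0 -> B k d = 0.
    move=> Bd; apply/eqP; apply: contraT => Bkd.
    by rewrite (reduced_mx_col Bkd Bd) eqxx in ki.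
  by rewrite !z// !mulr0 subrr.
have /colP/(_ b) : \det B *: c = 0.
  by rewrite -mul_scalar_mx -mul_adj_mx -mulmxA Bc mulmx0.
have cE (x y : {poly C}) :
    (x *: delta_mx b (0 : 'I_1) - y *: delta_mx b' 0) b 0 = x.
  by rewrite !mxE eqxx (negbTE bb') /= mulr1 mulr0 subr0.
rewrite [LHS]mxE [RHS]mxE cE => /eqP.
by rewrite mulf_eq0 (negbTE det_reduced_mx) (negbTE Bb').
Qed.

Lemma reduced_mx_row_neq0 i : exists b, B i b != 0.
Proof.
apply/existsP; have := det_reduced_mx; apply: contraNT.
rewrite negb_exists => /forallP h; rewrite (expand_det_row _ i) big1// => j _.
by have := h j; rewrite negbK => /eqP ->; rewrite mul0r.
Qed.

(* Test polynomials divisible by [B j c * u ^+ size D] turn [L c] into [M j] and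
   make the integrations by parts against the Pearson equation possible. *)
Lemma D_offdiag b c i j p : B i b != 0 -> B j c != 0 -> b != c ->
  (dact D (p *: delta_mx (0 : 'I_1) b)) 0 c = 0.
Proof.
move=> Bb Bc bc.
have ij : i != j by apply: contraNneq bc => ij; rewrite (reduced_mx_row Bb (b' := c))// ij.
have [Y hY] := FW_entry b; have [Z hZ] := FW_entry c.
pose E q := (dact D (q *: delta_mx (0 : 'I_1) b)) 0 c.
have key q h : L c (E q * (B j c * (u ^+ size D * h))) = 0.
  pose g := B j c * (u ^+ size D * h).
  (* For fixed [g] this functional vanishes on [P n] once [n] reaches [size g + l]. The weight of
     [P] is already diagonal, so the identity serves as [T]. *)
  have [|||H hH] := @row_functional_repr _ _ L 1%:M P monicP orthP1 posL 1%:M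
    (mulmx1 _) (fun r => L c ((dact D r) 0 c * g)) (size g + l).
  - by move=> r s; rewrite dactD mxE mulrDl linearD.
  - by move=> z r; rewrite dactZ mxE -mulrA mul_polyC linearZ.
  - by move=> n k hn; rewrite -row_dact mxE dact_orth_entry.
  have hH' x : L c (E x * g) = L b (H b * x).
    rewrite hH mulmx1 (bigD1 b)//= big1 => [|k kb].
      by rewrite !mxE !eqxx mulr1 addr0 mulrC.
    by rewrite !mxE (negbTE kb) andbF mulr0 mul0r linear0.
  have [G hG] := @pearson_parts_sum _ u (tau j) (M j)
    (fun k => (D`_k : mpoly) b c) (size D) (Z j * h) (pearsonM j).
  (* On arguments [B i b * x] one side becomes a functional of [M i], and the other, through [hZ]
     and integration by parts, one of [M j]; independence leaves zero. *)
  have /eqP : Y i * H b = 0.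
    apply: (indepM ij (g := G * B i b)) => x.
    rewrite -!mulrA -hY -hG -dact_delta -/(E _).
    transitivity (L b (H b * (B i b * x))); first by congr (L b _); ring.
    rewrite -hH'; transitivity (L c (B j c * (u ^+ size D * h * E (B i b * x)))).
      by congr (L c _); rewrite /g; ring.
    by rewrite hZ; congr (M j _); ring.
  rewrite mulf_eq0 (negbTE (FW_entry_neq0 (hY i) Bb)) /= => /eqP H0.
  by rewrite -/g hH' H0 mul0r linear0.
(* In [key] the free factor [h] is taken to be the conjugate of this whole product. *)
have /eqP : E p * (B j c * u ^+ size D) = 0.
  apply: (pos_fun_eq0 (posL c)).
  rewrite -[X in L c X]mulrA -[X in _ * X]mulrA; exact: key.
by rewrite !mulf_eq0 (negbTE Bc) expf_eq0 (negbTE u_neq0) andbF !orbF => /eqP.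
Qed.

Lemma diagonal_darboux_absurd : False.
Proof.
(* [n] is large enough for [Cn n] to be invertible, and positive so that constants have degree below
   [n]. *)
have [b Bb] := reduced_mx_row_neq0 i0; pose n := maxn n0 1.
have n0n : (n0 <= n)%N by rewrite leq_maxl.
have n_gt0 : (0 < n)%N by rewrite leq_maxr.
pose v := row b (Cn n); pose r := lift v *m Q n *m T.
(* [r *m B] is row [b] of [P n . D]. Since [P n] is diagonal, its entry [c] only involves the
   operator entry [(b, c)], which acts as zero. *)
have rB c : c != b -> (r *m B) 0 c = 0.
  move=> cb; rewrite /r /reduced_mx mulmxA -(mulmxA _ T) TT' mulmx1 /v map_row -!row_mul CQF.
  have [i Bi] : exists i, B i c != 0.
    apply/existsP; have := det_reduced_mx; apply: contraNT.
    rewrite negb_exists => /forallP h; rewrite (expand_det_col _ c) big1// => j _.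
    by have := h j; rewrite negbK => /eqP ->; rewrite mul0r.
  rewrite row_dact (_ : row b (P n) = P n b b *: delta_mx 0 b); last first.
    apply/rowP => k; rewrite !mxE eqxx /=; have [->|kb] := eqVneq k b.
      by rewrite mulr1.
    by rewrite mulr0 P_diag// eq_sym.
  by apply: (D_offdiag _ Bb Bi); rewrite eq_sym.
pose s := r 0 i0.
(* For [i] other than [i0], the nonzero entry of row [i] of [B] sits in a column [c] other than [b],
   and entry [c] of [r *m B] is [r 0 i * B i c]. *)
have rE : r = s *: delta_mx 0 i0.
  apply/rowP => i; rewrite [RHS]mxE [X in _ * X]mxE eqxx /=.
  have [->|ii0] := eqVneq i i0; first by rewrite mulr1.
  rewrite mulr0; have [c Bc] := reduced_mx_row_neq0 i.
  have cb : c != b.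
    by apply: contraNneq ii0 => cb; rewrite cb in Bc; rewrite (reduced_mx_col Bc Bb).
  have /eqP := rB c cb; rewrite mxE (bigD1 i)//= big1 => [|k ki].
    by rewrite addr0 mulf_eq0 (negbTE Bc) orbF => /eqP.
  apply/eqP; rewrite mulf_eq0; apply/orP; right; apply: contraT => Bk.
  by rewrite (reduced_mx_col Bk Bc) eqxx in ki.
(* Undoing [T] does not change the row, because row [i0] of [T'] is a unit row; hence [s] has degree
   at most [n]. *)
have vQ : lift v *m Q n = s *: delta_mx 0 i0.
  rewrite -[LHS]mulmx1 -TT' mulmxA -/r rE -scalemxAl; congr (_ *: _).
  by rewrite -rowE T'_i0.
have orth (x : {poly C}) c : (size x <= n)%N -> M i0 (s * conjp (x * T c i0)) = 0.
  move=> hx; transitivity (rform M r (x *: delta_mx 0 c *m T)).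
    rewrite /rform (bigD1 i0)//= big1 => [|k ki].
      have -> : (x *: delta_mx (0 : 'I_1) c *m T) 0 i0 = x * T c i0.
        by rewrite -scalemxAl -rowE 2!mxE.
      by rewrite addr0.
    by rewrite rE !mxE (negbTE ki) andbF mulr0 mul0r linear0.
  rewrite /r -mulmxA rform_lift_l big1// => k _.
  by rewrite (orth_lower monicQ orthQ) ?mulr0// => j; apply: size_delta.
have s_size : (size s <= n.+1)%N.
  have -> : s = (lift v *m Q n) 0 i0 by rewrite vQ !mxE !eqxx mulr1.
  exact: size_lift_monic.
have s0 : s = 0.
  apply: (pos_fun_eq0 (posM i0)).
  (* The part [p * 'X] is reached through [T i1 i0], whose factor ['X] raises the degree by one, and
     the constant through [T i0 i0]; together they make [s] orthogonal to itself. *)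
  suff [p [c [hp sE]]] : exists (p : {poly C}) c,
      (size p <= n)%N /\ s = p * 'X + c%:P.
    rewrite {2}sE conjpD mulrDr linearD /=.
    have -> : p * 'X = (a^-1 *: p) * T i1 i0.
      transitivity ((a^-1 * a)%:P * (p * 'X)); first by rewrite mulVf// mul1r.
      by rewrite T_i1 -mul_polyC polyCM; ring.
    have -> : c%:P = c%:P * T i0 i0 by rewrite T_i0 mulr1.
    transitivity (0 + 0 : C); last exact: addr0.
    congr (_ + _); apply: orth; first by rewrite size_scale// invr_eq0.
    exact: leq_trans (size_polyC_leq1 _) n_gt0.
  move: s_size; elim/poly_ind: (s) => [|p c _] hs.
    by exists 0, 0; rewrite mul0r add0r polyC0 size_poly0.
  exists p, c; split=> //; move: hs; rewrite size_MXaddC.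
  by case: ifP => // /andP[/eqP -> _]; rewrite size_poly0.
have : v = 0 by apply: (lift_monic_eq0 (monicQ n)); rewrite vQ s0 scale0r.
move/(congr1 (fun z => z *m invmx (Cn n))); rewrite -row_mul mulmxV ?unitC// mul0mx.
by move/rowP/(_ b); rewrite !mxE eqxx => /eqP; rewrite oner_eq0.
Qed.

End Core.

Local Open Scope classical_set_scope.

(** * Moment functionals of weights *)

Section Moments.
Variable R : realType.
Local Notation C := (R[i]).
Local Notation mu := (@lebesgue_measure R).
Local Notation measR := (@measurable _ (measurableTypeR R)).
Implicit Types (I : set R) (w f : R -> R) (p : {poly C}).

HB.instance Definition _ := GRing.RMorphism.copy (@RtoC R) (real_complex R).

(** Working from real moments makes complex linearity purely algebraic and avoids integrating
    complex functions. *)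
Definition moment_fun (m : nat -> R) p : C := \sum_(k < size p) p`_k * RtoC (m k).

Lemma moment_funE m p n : (size p <= n)%N ->
  moment_fun m p = \sum_(k < n) p`_k * RtoC (m k).
Proof.
move=> pn; rewrite /moment_fun (big_ord_widen n (fun k => p`_k * RtoC (m k)) pn).
rewrite big_mkcond; apply: eq_bigr => k _ /=.
by case: ltnP => // pk; rewrite nth_default// mul0r.
Qed.

Lemma moment_fun_is_scalar m : scalar (moment_fun m).
Proof.
move=> c p q; set n := maxn (size p) (size q).
have np : (size p <= n)%N by rewrite leq_maxl.
have nq : (size q <= n)%N by rewrite leq_maxr.
rewrite !(@moment_funE _ _ n)//; last first.
  rewrite (leq_trans (size_polyD _ _))// geq_max nq.
  by rewrite (leq_trans (size_scale_leq _ _)).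
rewrite mulr_sumr -big_split; apply: eq_bigr => k _ /=.
by rewrite coefD coefZ mulrDl mulrA.
Qed.

HB.instance Definition _ m :=
  GRing.isLinear.Build C {poly C} C *%R (moment_fun m) (moment_fun_is_scalar m).

Definition moment I w k : R := fine (\int[mu]_(x in I) (x ^+ k * w x)%:E).

Definition moments_finite I w :=
  measR I /\ forall k, mu.-integrable I (fun x => (x ^+ k * w x)%:E).

Definition weight_fun I w : {scalar {poly C}} := moment_fun (moment I w).

(** Integrability and value are kept together because additivity of the integral needs both. *)
Definition hasint I f (v : R) :=
  mu.-integrable I (EFin \o f) /\ (\int[mu]_(x in I) (f x)%:E = v%:E)%E.

Lemma hasint_moment I w k : moments_finite I w ->
  hasint I (fun x => x ^+ k * w x) (moment I w k).
Proof.
case=> mI h; split; first exact: h.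
by rewrite fineK//; exact: integrable_fin_num.
Qed.

Lemma hasintZ I f v r : measR I -> hasint I f v ->
  hasint I (fun x => r * f x) (r * v).
Proof.
move=> mI [h1 h2]; split.
  by apply: eq_integrable (integrableZl mI r h1).
by under eq_integral do rewrite EFinM; rewrite integralZl// h2.
Qed.

Lemma hasintD I f g v s : measR I -> hasint I f v -> hasint I g s ->
  hasint I (fun x => f x + g x) (v + s).
Proof.
move=> mI [f1 f2] [g1 g2]; split.
  by apply: eq_integrable (integrableD mI f1 g1).
by under eq_integral do rewrite EFinD; rewrite integralD// f2 g2.
Qed.

Lemma hasint_sum I (J : finType) (f : J -> R -> R) v : measR I ->
  (forall j, hasint I (f j) (v j)) ->
  hasint I (fun x => \sum_j f j x) (\sum_j v j).
Proof.
move=> mI h; elim: (index_enum J) => [|j s IH].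
  rewrite big_nil; under eq_fun do rewrite big_nil.
  by split; [exact: integrable0 | exact: integral0].
rewrite big_cons; under eq_fun do rewrite big_cons.
exact: hasintD.
Qed.

(** This treats the real and imaginary parts of an integrand uniformly. *)
Definition real_linear (phi : C -> R) :=
  {morph phi : x y / x + y} /\ (forall z r, phi (z * RtoC r) = phi z * r).

Lemma real_linear_sum phi (J : finType) (F : J -> C) : real_linear phi ->
  phi (\sum_j F j) = \sum_j phi (F j).
Proof.
case=> hD hZ; have h0 : phi 0 = 0 by rewrite -[in LHS](mulr0 0) (hZ _ 0) mulr0.
exact: (big_morph phi hD h0).
Qed.

Lemma real_linear_re : real_linear (@reC R).
Proof. by split=> [[a b] [c d]|[a b] r] //=; rewrite /reC/= mulr0 subr0. Qed.

Lemma real_linear_im : real_linear (@imC R).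
Proof. by split=> [[a b] [c d]|[a b] r] //=; rewrite /imC/= mulr0 add0r. Qed.

Lemma hasint_poly phi I w p : real_linear phi -> moments_finite I w ->
  hasint I (fun x => phi (p.[RtoC x] * RtoC (w x))) (phi (weight_fun I w p)).
Proof.
move=> hphi hw; have [_ hZ] := hphi; have mI := hw.1.
rewrite real_linear_sum//.
rewrite [X in hasint I X _](_ : _ =
    fun x => \sum_(k < size p) phi p`_k * (x ^+ k * w x)).
  apply: hasint_sum => // k; rewrite hZ; apply: hasintZ => //.
  exact: hasint_moment.
apply/funext => x; rewrite horner_coef mulr_suml real_linear_sum//.
apply: eq_bigr => k _; rewrite -hZ; congr phi.
by rewrite -mulrA rmorphM rmorphXn.
Qed.

(** * Matrix orthogonality in terms of moment functionals *)

Section InnerProduct.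
Variable N : nat.
Local Notation mpoly := 'M[{poly C}]_N.

Lemma evalmpM (P Q : mpoly) x : evalmp (P *m Q) x = evalmp P x *m evalmp Q x.
Proof. exact: (map_mxM (horner_eval (RtoC x))). Qed.

Lemma conj_RtoC (x : R) : Num.conj (RtoC x) = RtoC x.
Proof. exact: conjc_real. Qed.

Lemma horner_conjp p (x : R) : (conjp p).[RtoC x] = (p.[RtoC x])^*.
Proof.
by rewrite /conjp -[in LHS](conj_RtoC x) horner_map.
Qed.

Definition weight_funs I (w : 'I_N -> R -> R) k : {scalar {poly C}} :=
  weight_fun I (w k).

Lemma ip_zero_rform c d (W : R -> 'M[R]_N) (S : R -> 'M[R]_N) (T : mpoly)
    (w : 'I_N -> R -> R) (P Q : mpoly) :
  (forall x, evalmp T x = map_mx (@RtoC R) (S x)) ->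
  (forall x, W x = S x *m diag_mx (\row_i w i x) *m (S x)^T) ->
  (forall i, moments_finite (oitv c d) (w i)) ->
  ip_zero c d W P Q ->
  forall i j, rform (weight_funs (oitv c d) w)
    (row i (P *m T)) (row j (Q *m T)) = 0.
Proof.
move=> hT hW hw hPQ i j; set I := oitv c d.
have [k0|N0] := pselect (exists k : 'I_N, True); last by case: N0; exists i.
have mI : measR I by case: k0 => k _; exact: (hw k).1.
pose G k := (P *m T) i k * conjp ((Q *m T) j k).
have hf x : (evalmp P x *m map_mx (@RtoC R) (W x) *m adjC (evalmp Q x)) i j =
    \sum_k (G k).[RtoC x] * RtoC (w k x).
  rewrite hW !map_mxM/= map_diag_mx -map_trmx -hT !mulmxA -evalmpM -mulmxA.
  (* [T] has real values on the real line, so its transpose there is its adjoint. *)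
  have -> : (evalmp T x)^T *m adjC (evalmp Q x) = adjC (evalmp (Q *m T) x).
    rewrite /adjC evalmpM map_mxM trmx_mul; congr (_^T *m _).
    by rewrite hT -map_mx_comp; apply/matrixP => r s; rewrite !mxE/= conj_RtoC.
  rewrite mul_mx_diag mxE; apply: eq_bigr => k _.
  by rewrite /G hornerM horner_conjp !mxE mulrAC.
pose g := \sum_k weight_funs I w k (G k).
have hi phi : real_linear phi -> hasint I (fun x =>
   phi ((evalmp P x *m map_mx (@RtoC R) (W x) *m adjC (evalmp Q x)) i j)) (phi g).
  move=> hphi; rewrite [X in hasint I X _](_ : _ =
    fun x => \sum_k phi ((G k).[RtoC x] * RtoC (w k x))).
    by rewrite real_linear_sum//; apply: hasint_sum => // k; exact: hasint_poly.
  by apply/funext => x; rewrite hf real_linear_sum.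
have [/=] := hPQ i j.
rewrite (hi _ real_linear_re).2 (hi _ real_linear_im).2 => -[re0] [im0].
transitivity g.
  by apply: eq_bigr => k _; congr (weight_funs I w k (_ * conjp _)); rewrite mxE.
rewrite [g]complexE -/(reC g) -/(imC g) re0 im0 /=; apply/eqP.
by rewrite eq_complex/= !(mulr0, mul0r, addr0, subr0) eqxx.
Qed.

End InnerProduct.
End Moments.

(** * Positivity of the moment functional of a weight *)

Section Positivity.
Variable R : realType.
Local Notation C := (R[i]).
Local Notation mu := (@lebesgue_measure R).
Local Notation measR := (@measurable _ (measurableTypeR R)).
Implicit Types (I : set R) (w f : R -> R) (p : {poly C}).

Lemma horner_mul_conjp p (x : R) :
  (p * conjp p).[RtoC x] = RtoC (reC p.[RtoC x] ^+ 2 + imC p.[RtoC x] ^+ 2).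
Proof.
rewrite hornerM horner_conjp; case: (p.[RtoC x]) => a b.
by apply/eqP; rewrite eq_complex /= /reC /imC/=; apply/andP; split; apply/eqP; ring.
Qed.

Lemma negligible_roots p : p != 0 ->
  {ae mu, forall x, p.[RtoC x] != 0}.
Proof.
move=> p0; have [rs pE] := closed_field_poly_normal p.
(* A real root is its own real part, so this finite set contains every real root. *)
pose Z := [set` map (@complex.Re R) rs].
have cZ : countable Z by apply: finite_set_countable; exact: finite_seq.
exists Z; split.
- exact: countable_measurable.
- exact: countable_lebesgue_measure0.
- move=> x /= /negP; rewrite negbK -/(root p _) pE rootZ ?lead_coef_eq0//.
  by rewrite root_prod_XsubC => xrs; apply/mapP; exists (RtoC x).
Qed.

(** The integral of [|p|^2 w] is nonnegative. If it were zero the integrand would vanish almost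
    everywhere on [I], yet it is positive off the negligible roots of [p], so [I] would be
    negligible. *)
Lemma weight_fun_pos I w : moments_finite I w ->
  {ae mu, forall x, I x -> 0 < w x} -> mu I != 0%E -> pos_fun (weight_fun I w).
Proof.
move=> hw wpos I0 p p0; have mI := hw.1; set q := p * conjp p.
have [ire vre] := hasint_poly q (real_linear_re R) hw.
have [_ vim] := hasint_poly q (real_linear_im R) hw.
have q_re x : reC (q.[RtoC x] * RtoC (w x)) =
    (reC p.[RtoC x] ^+ 2 + imC p.[RtoC x] ^+ 2) * w x.
  by rewrite /q horner_mul_conjp -rmorphM.
have q_im x : imC (q.[RtoC x] * RtoC (w x)) = 0.
  by rewrite /q horner_mul_conjp -rmorphM.
have im0 : imC (weight_fun I w q) = 0.
  by apply: EFin_inj; rewrite -vim; apply: integral0_eq => x _; rewrite q_im.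
have mf := measurable_int _ ire.
have re_abs : (\int[mu]_(x in I) `|(reC (q.[RtoC x] * RtoC (w x)))%:E|)%E =
    (reC (weight_fun I w q))%:E.
  rewrite -vre; apply: ae_eq_integral => //.
    exact: measurable_int (integrable_abse ire).
  case: wpos => Z [mZ Z0 hZ]; exists Z; split=> // x hx; apply: hZ => wx; apply: hx.
  move=> Ix; congr EFin; rewrite ger0_norm// q_re mulr_ge0 ?(ltW (wx Ix))//.
  by rewrite addr_ge0// sqr_ge0.
rewrite ltcE -/(imC _) -/(reC _) im0 eqxx /=.
have : (0 <= (reC (weight_fun I w q))%:E)%E by rewrite -re_abs; exact: integral_ge0.
rewrite lee_fin le_eqVlt => /predU1P[re0|//]; exfalso.
move: re_abs; rewrite -re0 => /(ae_eq_integral_abs _ mI mf) h0.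
have hI : {ae mu, forall x, ~ I x}.
  move: h0 wpos (negligible_roots p0); apply: filterS3 => x /= h0 wx px Ix.
  have /eqP : reC (q.[RtoC x] * RtoC (w x)) = 0 by apply: EFin_inj; exact: h0.
  rewrite q_re mulf_eq0 (gt_eqF (wx Ix)) orbF.
  rewrite paddr_eq0 ?sqr_ge0// !sqrf_eq0 => /andP[/eqP a0 /eqP b0].
  by case/negP: px; rewrite eq_complex; apply/andP; split; apply/eqP.
move/eqP: I0; apply; apply: measure_negligible => //.
by move: hI; rewrite /almost_everywhere; apply: negligibleS => x Ix /=.
Qed.

End Positivity.

(** * Integration by parts along an exhaustion *)

Section Exhaustion.
Variable R : realType.
Local Notation mu := (@lebesgue_measure R).
Local Notation measR := (@measurable _ (measurableTypeR R)).

Lemma is_derive_continuous (f : R -> R) (x df : R) :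
  is_derive x 1 f df -> {for x, continuous f}.
Proof.
move=> [fx _]; apply: differentiable_continuous; exact/derivable1_diffP.
Qed.

Lemma integral_segment (f F : R -> R) (a b : R) : a <= b ->
  (forall x, a <= x <= b -> is_derive x 1 F (f x)) ->
  (forall x, a <= x <= b -> {for x, continuous f}) ->
  (\int[mu]_(x in `[a, b]) (f x)%:E = (F b - F a)%:E)%E.
Proof.
rewrite le_eqVlt => /predU1P[<- _ _|ab dF cf].
  by rewrite set_itv1 integral_set1 subrr.
rewrite (continuous_FTC2 (F := F)) ?EFinB//.
- apply: continuous_in_subspaceT => x /[!inE]/=; rewrite in_itv/=; exact: cf.
- have cF x : a <= x <= b -> {for x, continuous F}.
    by move=> xab; exact: is_derive_continuous (dF x xab).
  split.
  + move=> x; rewrite in_itv/= => /andP[ax xb].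
    by have [] : is_derive x 1 F (f x) by apply: dF; rewrite !ltW.
  + by apply: cvg_at_right_filter; apply: cF; rewrite lexx ltW.
  + by apply: cvg_at_left_filter; apply: cF; rewrite lexx ltW.
- move=> x; rewrite in_itv/= => /andP[ax xb].
  have [] : is_derive x 1 F (f x) by apply: dF; rewrite !ltW.
  by move=> _ <-; rewrite derive1E.
Qed.

Variables (I : set R) (a b : R^nat).
Hypothesis openI : open I.
Hypothesis ab : forall n, a n <= b n.
Hypothesis a_dec : forall m n, (m <= n)%N -> a n <= a m.
Hypothesis b_inc : forall m n, (m <= n)%N -> b m <= b n.
Hypothesis IE : I = \bigcup_n `[a n, b n].

Lemma exhaust_measurable : measR I.
Proof. exact: open_measurable. Qed.

Lemma exhaust_sub n x : a n <= x <= b n -> I x.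
Proof. by move=> h; rewrite IE; exists n => //=; rewrite in_itv. Qed.

Let seg n : set R := `[a n, b n].

Let seg_nd : nondecreasing_seq seg.
Proof.
move=> m n mn; apply/subsetPset => x; rewrite /seg /= !in_itv/= => /andP[h1 h2].
by rewrite (le_trans (a_dec mn))//= (le_trans h2)// b_inc.
Qed.

Let seg_meas n : measR (seg n).
Proof. exact: measurable_itv. Qed.

Variables f F : R -> R.
Hypothesis dF : forall x, I x -> is_derive x 1 F (f x).
Hypothesis cf : forall x, I x -> {for x, continuous f}.

Lemma exhaust_measurable_fun : measurable_fun (I : set (measurableTypeR R)) f.
Proof.
by apply: open_continuous_measurable_fun => // x /[!inE]; exact: cf.
Qed.

Lemma exhaust_integral n :
  (\int[mu]_(x in `[a n, b n]) (f x)%:E = (F (b n) - F (a n))%:E)%E.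
Proof.
by apply: integral_segment => // x /exhaust_sub; [exact: dF | exact: cf].
Qed.

(** Monotone convergence along the segments, whose integrals [F (b n) - F (a n)] are at most
    [K + K]. *)
Lemma integrable_bounded_primitive (K : R) : (forall x, I x -> 0 <= f x) ->
  (forall x, I x -> `|F x| <= K) -> mu.-integrable I (EFin \o f).
Proof.
move=> f0 FK; have mf := exhaust_measurable_fun.
have mfE : measurable_fun (I : set (measurableTypeR R)) (EFin \o f).
  exact/measurable_EFinP.
apply/integrableP; split=> //.
have -> : (\int[mu]_(x in I) `|(EFin \o f) x| = \int[mu]_(x in I) (f x)%:E)%E.
  by apply: eq_integral => x /[!inE] Ix /=; rewrite ger0_norm// f0.
have : (\int[mu]_(x in seg i) (f x)%:E @[i --> \oo] -->
    \int[mu]_(x in \bigcup_i seg i) (f x)%:E)%E.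
  have := @ge0_nondecreasing_set_cvg_integral _ (measurableTypeR R) R seg
    (EFin \o f) mu seg_nd seg_meas; apply.
  - move=> i; apply: (measurable_funS exhaust_measurable) => //.
    by move=> x; rewrite /seg/= in_itv/=; exact: exhaust_sub.
  - by move=> i x; rewrite /seg/= in_itv/= lee_fin => /exhaust_sub /f0.
rewrite -IE => h; apply: (@le_lt_trans _ _ (K + K)%:E); last exact: ltry.
have /cvg_lim <- // := h; apply: lime_le; first by apply/cvg_ex; eexists; exact: h.
apply: nearW => n; rewrite exhaust_integral lee_fin.
have Ia : I (a n) by apply: (@exhaust_sub n); rewrite lexx ab.
have Ib : I (b n) by apply: (@exhaust_sub n); rewrite lexx ab.
by have := FK _ Ia; have := FK _ Ib; rewrite !ler_norml; lra.
Qed.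

(** Monotone convergence for the positive and negative parts shows that the segment integrals tend
    to the full one; they equal the differences of [F]. *)
Lemma integral_primitive_vanishing : mu.-integrable I (EFin \o f) ->
  (fun n => F (b n) - F (a n)) @ \oo --> (0 : R) ->
  (\int[mu]_(x in I) (f x)%:E = 0)%E.
Proof.
move=> intf F0.
have h : (\int[mu]_(x in seg n) (f x)%:E @[n --> \oo] -->
    \int[mu]_(x in I) (f x)%:E)%E.
  have [ip im] := (integrable_funepos exhaust_measurable intf,
                   integrable_funeneg exhaust_measurable intf).
  have sub i : seg i `<=` I.
    by move=> x; rewrite /seg/= in_itv/=; exact: exhaust_sub.
  have cvg_ge0 g : mu.-integrable I g -> (forall x, 0 <= g x)%E ->
      (\int[mu]_(x in seg n) g x @[n --> \oo] --> \int[mu]_(x in I) g x)%E.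
    move=> ig g0; rewrite [in X in _ --> X]IE.
    apply: (@ge0_nondecreasing_set_cvg_integral _ (measurableTypeR R) R seg g
      mu seg_nd seg_meas) => // i.
    exact: measurable_funS exhaust_measurable (sub i) (measurable_int _ ig).
  rewrite integralE; under eq_fun do rewrite integralE.
  apply: cvgeB; [|exact: cvg_ge0|exact: cvg_ge0].
  by apply: fin_num_adde_defr; exact: (integrable_fin_num exhaust_measurable).
apply: (@cvg_unique _ _ _ _ _ _ h) => //.
rewrite (_ : (fun n => _) = EFin \o (fun n => F (b n) - F (a n))).
  by apply/fine_cvgP; split; [exact: nearW | exact: F0].
by apply/funext => n; rewrite exhaust_integral.
Qed.

End Exhaustion.

(** * From a differential equation with vanishing boundary terms to a Pearson functional *)

Section PearsonWeight.
Variable R : realType.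
Local Notation C := (R[i]).
Local Notation mu := (@lebesgue_measure R).
Local Notation measR := (@measurable _ (measurableTypeR R)).
Local Notation polyRC := (map_poly (@RtoC R)).

Lemma weight_fun_real_eq0 I w (r : {poly R}) : moments_finite I w ->
  (\int[mu]_(x in I) (r.[x] * w x)%:E = 0)%E -> weight_fun I w (polyRC r) = 0.
Proof.
move=> hw r0.
have [_ vre] := hasint_poly (polyRC r) (real_linear_re R) hw.
have [_ vim] := hasint_poly (polyRC r) (real_linear_im R) hw.
have E x : (polyRC r).[RtoC x] * RtoC (w x) = RtoC (r.[x] * w x).
  by rewrite horner_map -rmorphM.
apply/eqP; rewrite eq_complex -/(reC _) -/(imC _); apply/andP; split; apply/eqP.
  apply: EFin_inj; rewrite -vre -[RHS]r0.
  by apply: eq_integral => x _; rewrite E.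
by apply: EFin_inj; rewrite -vim; apply: integral0_eq => x _; rewrite E.
Qed.

(** One integrable majorant serves all moments; for each classical family it will be the derivative
    of a bounded function. *)
Lemma moments_dominated (I : set R) (w phi : R -> R) : open I ->
  (forall x, I x -> {for x, continuous w}) -> mu.-integrable I (EFin \o phi) ->
  (forall k, exists c, forall x, I x -> `|x ^+ k * w x| <= c * phi x) ->
  moments_finite I w.
Proof.
move=> oI cw iphi hdom; have mI : measR I by exact: open_measurable.
split=> // k; have [c hc] := hdom k.
apply: (le_integrable mI (g := fun x => (c%:E * (EFin \o phi) x)%E)).
- apply/measurable_EFinP; apply: open_continuous_measurable_fun => // x /[!inE] Ix.
  by apply: cvgM; [exact: exprn_continuous | exact: cw].
- move=> x Ix /=; by rewrite lee_fin (le_trans (hc x Ix))// ler_norm.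
- exact: (integrableZl mI c iphi).
Qed.

Variables (I : set R) (a b : R^nat).
Hypothesis openI : open I.
Hypothesis ab : forall n, a n <= b n.
Hypothesis a_dec : forall m n, (m <= n)%N -> a n <= a m.
Hypothesis b_inc : forall m n, (m <= n)%N -> b m <= b n.
Hypothesis IE : I = \bigcup_n `[a n, b n].

(** By linearity [q] may be a monomial ['X^k]; the integrand is then the derivative of [x ^+ k *
    (u.[x] * w x)], whose boundary values vanish. *)
Lemma pearson_weight (w : R -> R) (u tau : {poly R}) : moments_finite I w ->
  (forall x, I x -> {for x, continuous w}) ->
  (forall x, I x -> is_derive x 1 (fun x => u.[x] * w x) (tau.[x] * w x)) ->
  (forall k, (fun n => b n ^+ k * (u.[b n] * w (b n))) @ \oo --> (0 : R)) ->
  (forall k, (fun n => a n ^+ k * (u.[a n] * w (a n))) @ \oo --> (0 : R)) ->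
  pearson (polyRC u) (polyRC tau) (weight_fun I w).
Proof.
move=> hw cw dw hb ha q; rewrite -[q]coefK poly_def.
elim/big_ind : _ => [|p1 p2 h1 h2|k _].
- by rewrite deriv0 !mulr0 addr0 linear0.
- rewrite derivD !mulrDr addrACA linearD /= h1 h2; exact: addr0.
rewrite derivZ -!scalerAr -scalerDr linearZ /= [X in _ * X](_ : _ = 0) ?mulr0//.
have -> : polyRC u * 'X^k^`() + polyRC tau * 'X^k =
    polyRC (u * 'X^k^`() + tau * 'X^k).
  by rewrite rmorphD !rmorphM /= -deriv_map map_polyXn.
apply: weight_fun_real_eq0 => //.
pose F x := 'X^k.[x] * (u.[x] * w x).
have dF x : I x -> is_derive x 1 F ((u * 'X^k^`() + tau * 'X^k).[x] * w x).
  move=> Ix; have du := dw x Ix.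
  apply: (is_derive_eq (is_deriveM (is_derive_poly 'X^k x) du)).
  by rewrite /GRing.scale/= !hornerD !hornerM; ring.
have cf x : I x ->
    {for x, continuous (fun x => (u * 'X^k^`() + tau * 'X^k).[x] * w x)}.
  by move=> Ix; apply: cvgM; [exact: continuous_horner | exact: cw].
apply: (integral_primitive_vanishing openI ab a_dec b_inc IE dF cf).
- have hp := (hasint_poly (polyRC (u * 'X^k^`() + tau * 'X^k))
    (real_linear_re R) hw).1.
  apply: eq_integrable hp; first exact: hw.1.
  by move=> x _ /=; rewrite horner_map -rmorphM.
- rewrite -[0]subr0; apply: cvgB.
    by rewrite /F; under eq_fun do rewrite hornerXn; exact: hb.
  by rewrite /F; under eq_fun do rewrite hornerXn; exact: ha.
Qed.

Lemma cvg_geometric_bound (x : R^nat) (c z : R) : 0 <= z < 1 ->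
  (forall n, `|x n| <= c * z ^+ n) -> x @ \oo --> (0 : R).
Proof.
move=> /andP[z0 z1] hx; have hz : `|z| < 1 by rewrite ger0_norm.
have h := cvg_geometric c hz.
apply: (@squeeze_cvgr _ _ _ _ (fun n => - geometric c z n) (geometric c z)) => //.
  by apply: nearW => n; rewrite -ler_norml; exact: hx.
by rewrite -[0]oppr0; exact: cvgN.
Qed.

End PearsonWeight.

(** * Hermite, Laguerre and Jacobi weights *)

Section ClassicalWeights.
Variable R : realType.
Local Notation mu := (@lebesgue_measure R).
Local Notation polyRC := (map_poly (@RtoC R)).
Implicit Types (x y s : R).

Lemma expr_le_expR n x : 0 <= x -> x ^+ n <= n`!%:R * expR x.
Proof.
case: n => [|n] x0.
  by rewrite expr0 mul1r (le_trans _ (expR_ge1Dx x))// lerDl.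
have h := expR_ge1Dxn n x0.
have f0 : 0 < n.+1`!%:R :> R by rewrite ltr0n fact_gt0.
by rewrite mulrC -ler_pdivrMr// (le_trans _ h)// lerDr.
Qed.

Lemma expR_nat_unbounded y : exists n, y <= expR n%:R.
Proof.
exists (Num.truncn y).+1; apply: le_trans (expR_ge1Dx _).
by rewrite (le_trans (ltW (truncnS_gt y)))// lerDr.
Qed.

Lemma powR_S x s : 0 < x -> x `^ s = x * x `^ (s - 1).
Proof.
move=> x0; have := @powRD _ x (s - 1) 1.
by rewrite subrK powRr1 ?(ltW x0)// mulrC => -> //; rewrite (gt_eqF x0) implybT.
Qed.

Lemma powR_le1 x s : 0 <= s -> 0 <= x <= 1 -> x `^ s <= 1.
Proof.
move=> s0 /andP[x0 x1]; rewrite -[leRHS](congr1 (fun f => f s) (@powR1 R)).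
apply: ge0_ler_powR => //.
by rewrite nnegrE.
Qed.

Lemma powR_le2 x s : 0 <= s -> 0 <= x <= 2 -> x `^ s <= 2 `^ s.
Proof.
by move=> s0 /andP[x0 x1]; apply: ge0_ler_powR => //; rewrite nnegrE.
Qed.

(** With an integer [m] above [s], the power is at most 1 on (0, 1] and at most [x ^+ m] beyond, and
    [x ^+ m] is at most [m!] times the exponential. *)
Lemma powR_expRN_bounded s : 0 <= s ->
  exists c, forall x, 0 < x -> x `^ s * expR (- x) <= c.
Proof.
move=> s0; pose m := (Num.truncn s).+1.
exists (1 + m`!%:R) => x x0; rewrite expRN ler_pdivrMr ?expR_gt0//.
have xs : x `^ s <= 1 + x ^+ m.
  have [x1|x1] := leP x 1.
    apply: (@le_trans _ _ 1); first by apply: powR_le1 => //; rewrite (ltW x0).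
    by rewrite lerDl exprn_ge0// ltW.
  apply: (@le_trans _ _ (x `^ m%:R)).
    by apply: ler_powR; [exact: ltW | rewrite ltW// truncnS_gt].
  by rewrite powR_mulrn ?(ltW x0)// lerDr.
rewrite (le_trans xs)// mulrDl mul1r lerD ?expr_le_expR ?(ltW x0)//.
by rewrite (le_trans _ (expR_ge1Dx x))// lerDl ltW.
Qed.

Lemma powR_expRn n s : (expR (- n%:R)) `^ s = expR (- s) ^+ n :> R.
Proof. by rewrite -expRM -expRM_natl mulNr -mulrN. Qed.

Lemma expRN_01 s : 0 < s -> 0 <= expR (- s) < 1.
Proof. by move=> s0; rewrite expR_ge0 expR_lt1 oppr_lt0. Qed.

Lemma powR_continuous x s : 0 < x ->
  {for x, continuous (fun y : R => y `^ s)}.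
Proof. by move=> x0; exact: (is_derive_continuous (is_derive1_powR s x0)). Qed.

(** * Hermite weights: finite moments and Pearson equation *)

Section Hermite.
Variable b : R.
Let w := w_hermite b.
(* Exponentially spaced endpoints make the boundary terms decay geometrically. *)
Let lo (n : nat) : R := - expR n%:R.
Let hi (n : nat) : R := expR n%:R.

Let lohi n : lo n <= hi n.
Proof. by rewrite /lo /hi; have := expR_gt0 (n%:R : R); lra. Qed.

Let hi_inc m n : (m <= n)%N -> hi m <= hi n.
Proof. by move=> mn; rewrite ler_expR ler_nat. Qed.

Let lo_dec m n : (m <= n)%N -> lo n <= lo m.
Proof. by move=> mn; rewrite lerN2 hi_inc. Qed.

Let IE : [set: R] = \bigcup_n `[lo n, hi n].
Proof.
apply/seteqP; split=> // x _; have [n hn] := expR_nat_unbounded `|x|.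
by exists n => //=; rewrite in_itv/= -ler_norml.
Qed.

Lemma oitvT : oitv -oo%E +oo%E = [set: R].
Proof. by apply/seteqP; split=> // x _; rewrite /oitv/= ltNyr ltry. Qed.

Lemma is_derive_hermite x : is_derive x 1 w ((- 2 * x + 2 * b) * w x).
Proof.
pose p : {poly R} := - 'X^2 + (2 * b)%:P * 'X.
have -> : w = expR \o horner p.
  by apply/funext => y; rewrite /w /w_hermite /p/= !hornerE.
apply: (is_derive_eq (is_derive1_comp (is_derive_expR _) (is_derive_poly p x))).
rewrite /p /= !(poly.derivE, hornerE).
ring.
Qed.

Lemma hermite_bounded k : exists c, forall x, `|x ^+ k * w x| <= c.
Proof.
(* [|x| ^+ k] is at most [k!] times the exponential of [|x|]; the total exponent is then at most
   [c |x| - x^2], and completing the square bounds it by [c ^+ 2 / 4]. *)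
pose c := 1 + 2 * `|b|.
exists (k`!%:R * expR (c ^+ 2 / 4)) => x.
rewrite normrM normrX (ger0_norm (expR_ge0 _)).
apply: (le_trans (ler_wpM2r (expR_ge0 _) (expr_le_expR k (normr_ge0 x)))).
rewrite -[leLHS]mulrA; apply: ler_wpM2l; first exact: ler0n.
rewrite /w /w_hermite -expRD ler_expR.
have h1 : b * x <= `|b| * `|x| by rewrite -normrM ler_norm.
have h2 : x ^+ 2 = `|x| ^+ 2 by rewrite -normrX ger0_norm// sqr_ge0.
rewrite h2 /c; have := sqr_ge0 (`|x| - (1 + 2 * `|b|) / 2).
nra.
Qed.

Let cw x : {for x, continuous w}.
Proof. exact: is_derive_continuous (is_derive_hermite x). Qed.

Let phi x := (1 + x ^+ 2)^-1.

Let cphi x : {for x, continuous phi}.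
Proof.
apply: cvgV; first by rewrite gt_eqF// ltr_pwDl// sqr_ge0.
by apply: cvgD; [exact: cvg_cst | exact: exprn_continuous].
Qed.

Let iphi : mu.-integrable [set: R] (EFin \o phi).
Proof.
apply: (@integrable_bounded_primitive R setT lo hi openT lohi lo_dec hi_inc IE
  phi (@atan R) _ _ (pi / 2)) => // x _.
- by rewrite invr_ge0 addr_ge0// sqr_ge0.
- by rewrite ler_norml !ltW ?atan_gtNpi2 ?atan_ltpi2.
Qed.

Let dom k : exists c, forall x, `|x ^+ k * w x| <= c * phi x.
Proof.
have [c1 h1] := hermite_bounded k; have [c2 h2] := hermite_bounded k.+2.
exists (c1 + c2) => x; rewrite ler_pdivlMr; last by rewrite ltr_pwDl// sqr_ge0.
rewrite mulrDr mulr1 lerD//.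
rewrite -[X in _ * X](ger0_norm (sqr_ge0 x)) -normrM.
by have := h2 x; rewrite -addn2 exprD mulrAC.
Qed.

Lemma moments_finite_hermite : moments_finite (oitv -oo%E +oo%E) w.
Proof.
rewrite oitvT; apply: (moments_dominated openT _ iphi) => [x _|k]; first exact: cw.
by have [c hc] := dom k; exists c => x _.
Qed.

Lemma pearson_hermite :
  pearson (polyRC 1) (polyRC (- 2%:P * 'X + (2 * b)%:P))
    (weight_fun (oitv -oo%E +oo%E) w).
Proof.
have hm := moments_finite_hermite; rewrite oitvT in hm *.
(* The bound for the power [k.+1] leaves a spare factor [|x n|], at least [expR n%:R], which gives
   geometric decay. *)
have small k (x : R^nat) : (forall n, expR n%:R <= `|x n|) ->
    (fun n => x n ^+ k * (1.[x n] * w (x n))) @ \oo --> (0 : R).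
  move=> hx; have [c hc] := hermite_bounded k.+1.
  apply: (@cvg_geometric_bound _ _ c (expR (- 1)) (expRN_01 ltr01)) => n.
  have e0 := expR_gt0 (n%:R : R).
  rewrite hornerC mul1r -expRM_natl mulrN1 expRN ler_pdivlMr//.
  apply: le_trans (hc (x n)); rewrite exprS -mulrA [leRHS]normrM mulrC.
  by rewrite ler_wpM2r.
apply: (pearson_weight openT lohi lo_dec hi_inc IE hm) => [x _|x _|k|k].
- exact: cw.
- apply: (is_derive_eq (is_deriveM (is_derive_poly 1 x) (is_derive_hermite x))).
  by rewrite /GRing.scale/= poly.derivE !hornerE /=; ring.
- by apply: small => n; rewrite ger0_norm// expR_ge0.
- by apply: small => n; rewrite normrN ger0_norm// expR_ge0.
Qed.

End Hermite.

(** * Laguerre weights: finite moments and Pearson equation *)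

Section Laguerre.
Variable al : R.
Hypothesis al_gt : -1 < al.
Let s := al + 1.
Let w := w_laguerre al.
Let I : set R := [set x | 0 < x].
Let lo (n : nat) : R := expR (- n%:R).
Let hi (n : nat) : R := expR n%:R.

Let s_gt0 : 0 < s. Proof. by rewrite /s -(ltrBlDr) sub0r. Qed.

Let openI : open I. Proof. exact: open_gt. Qed.

Let I_gt0 x : I x -> 0 < x.
Proof. by []. Qed.

Let lohi n : lo n <= hi n.
Proof. by rewrite ler_expR; have : 0 <= n%:R :> R by []; lra. Qed.

Let hi_inc m n : (m <= n)%N -> hi m <= hi n.
Proof. by move=> mn; rewrite ler_expR ler_nat. Qed.

Let lo_dec m n : (m <= n)%N -> lo n <= lo m.
Proof. by move=> mn; rewrite ler_expR lerN2 ler_nat. Qed.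

Let IE : I = \bigcup_n `[lo n, hi n].
Proof.
apply/seteqP; split=> x; last first.
  case=> n _ /=; rewrite in_itv/= => /andP[h _].
  exact: lt_le_trans (expR_gt0 _) h.
move=> /I_gt0 x0; have [n hn] := expR_nat_unbounded (x + x^-1).
have xi0 : 0 < x^-1 by rewrite invr_gt0.
exists n => //=; rewrite in_itv/=; apply/andP; split; last first.
  by apply: le_trans hn; rewrite lerDl ltW.
by rewrite /lo expRN invf_ple ?posrE ?expR_gt0// (le_trans _ hn)// lerDr ltW.
Qed.

Lemma oitv_laguerre : oitv 0%:E +oo%E = I.
Proof.
by apply/seteqP; split=> x; rewrite /oitv/I/= lte_fin ltry andbT.
Qed.

Lemma is_derive_laguerre x : 0 < x ->
  is_derive x 1 w ((al - x) * expR (- x) * x `^ (al - 1)).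
Proof.
move=> x0; have d1 : is_derive x 1 (fun y : R => expR (- y)) (- expR (- x)).
  apply: (is_derive_eq (is_derive1_comp (is_derive_expR _) (is_deriveNid x 1))).
  by rewrite mulrN1.
apply: (is_derive_eq (is_deriveM d1 (is_derive1_powR al x0))).
by rewrite /GRing.scale/= [x `^ al]powR_S//; ring.
Qed.

Let cw x : I x -> {for x, continuous w}.
Proof.
by move=> /I_gt0 x0; exact: is_derive_continuous (is_derive_laguerre x0).
Qed.

(** The derivative of [atan (x]^ s)[: it is comparable to]x [^ al] near 0, matching a possible
    singularity of [w], and integrable at infinity. *)
Let phi x := (1 + (x `^ s) ^+ 2)^-1 * (s * x `^ (s - 1)).

Let dphi x : I x -> is_derive x 1 (fun y => atan (y `^ s)) (phi x).
Proof.
move=> /I_gt0 x0.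
exact: (is_derive1_comp (is_derive1_atan _) (is_derive1_powR s x0)).
Qed.

Let den_gt0 x : 0 < 1 + (x `^ s) ^+ 2.
Proof. by rewrite ltr_pwDl// sqr_ge0. Qed.

Let cphi x : I x -> {for x, continuous phi}.
Proof.
move=> /I_gt0 x0; apply: cvgM.
  apply: cvgV; first by rewrite gt_eqF.
  apply: cvgD; first exact: cvg_cst.
  by apply: cvgM; exact: powR_continuous.
by apply: cvgM; [exact: cvg_cst | exact: powR_continuous].
Qed.

Let iphi : mu.-integrable I (EFin \o phi).
Proof.
apply: (@integrable_bounded_primitive R I lo hi openI lohi lo_dec hi_inc IE
  phi (fun y => atan (y `^ s)) dphi cphi (pi / 2)) => x _.
- by rewrite mulr_ge0 ?invr_ge0 ?(ltW (den_gt0 x))// mulr_ge0 ?powR_ge0// ltW.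
- by rewrite ler_norml !ltW ?atan_gtNpi2 ?atan_ltpi2.
Qed.

Let powR_shift k x r : 0 < x -> x ^+ k * x `^ r = x `^ (k%:R + r).
Proof.
by move=> x0; rewrite powRD ?powR_mulrn ?(ltW x0)// (gt_eqF x0) implybT.
Qed.

Let dom k : exists c, forall x, I x -> `|x ^+ k * w x| <= c * phi x.
Proof.
have [c1 h1] := @powR_expRN_bounded k%:R (ler0n _ _).
have s2 : 0 <= k%:R + (s + s).
  by apply: addr_ge0; [exact: ler0n | apply: addr_ge0; exact: ltW].
have [c2 h2] := powR_expRN_bounded s2.
exists ((c1 + c2) / s) => x /I_gt0 x0.
have e : s - 1 = al by rewrite /s addrK.
have -> : (c1 + c2) / s * phi x = (c1 + c2) * x `^ al / (1 + (x `^ s) ^+ 2).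
  by rewrite /phi e; field; rewrite !gt_eqF.
rewrite ler_pdivlMr//.
rewrite ger0_norm; last first.
  by rewrite mulr_ge0 ?exprn_ge0 ?(ltW x0)// mulr_ge0 ?expR_ge0 ?powR_ge0.
have -> : x ^+ k * w x * (1 + (x `^ s) ^+ 2) =
   (x `^ k%:R * expR (- x) + x `^ (k%:R + (s + s)) * expR (- x)) * x `^ al.
  rewrite -powR_shift// powR_mulrn ?(ltW x0)// powRD; last first.
    by rewrite (gt_eqF x0) implybT.
  by rewrite /w /w_laguerre; ring.
by rewrite ler_wpM2r ?powR_ge0// lerD ?h1 ?h2.
Qed.

Lemma moments_finite_laguerre : moments_finite (oitv 0%:E +oo%E) w.
Proof. by rewrite oitv_laguerre; exact: (moments_dominated openI cw iphi dom). Qed.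

Lemma pearson_laguerre :
  pearson (polyRC 'X) (polyRC (- 'X + s%:P)) (weight_fun (oitv 0%:E +oo%E) w).
Proof.
have hm := moments_finite_laguerre; rewrite oitv_laguerre in hm *.
have xw x k : 0 < x -> x ^+ k * ('X.[x] * w x) = x `^ (k%:R + s) * expR (- x).
  move=> x0; rewrite -powR_shift// hornerX /w /w_laguerre /s.
  by rewrite [x `^ (al + 1)]powR_S// addrK; ring.
apply: (pearson_weight openI lohi lo_dec hi_inc IE hm cw) => [x /I_gt0 x0|k|k].
- apply: (is_derive_eq (is_deriveM (is_derive_poly 'X x) (is_derive_laguerre x0))).
  rewrite /GRing.scale/= poly.derivE !hornerE /= /w /w_laguerre.
  rewrite [x `^ al]powR_S// /s.
  ring.
(* At infinity one extra power of [x] is bounded as well, which yields the geometric factor. *)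
- have ks : 0 <= k.+1%:R + s by apply: addr_ge0; [exact: ler0n | exact: ltW].
  have [c hc] := powR_expRN_bounded ks.
  apply: (@cvg_geometric_bound _ _ c (expR (- 1)) (expRN_01 ltr01)) => n.
  have e0 := expR_gt0 (n%:R : R).
  rewrite xw// ger0_norm ?mulr_ge0 ?powR_ge0 ?expR_ge0//.
  have -> : expR (- 1) ^+ n = (expR n%:R)^-1 :> R.
    by rewrite -expRM_natl mulrN1 expRN.
  rewrite ler_pdivlMr//.
  apply: le_trans (hc _ e0); rewrite -!powR_shift// exprS.
  by rewrite /hi le_eqVlt; apply/orP; left; apply/eqP; ring.
- apply: (@cvg_geometric_bound _ _ 1 (expR (- s)) (expRN_01 s_gt0)) => n.
  have e0 := expR_gt0 (- n%:R : R).
  rewrite xw// ger0_norm ?mulr_ge0 ?powR_ge0 ?expR_ge0//.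
  rewrite mul1r -powR_expRn -/(lo n) -powR_shift// -mulrA mulrCA.
  rewrite ler_piMr ?powR_ge0//.
  rewrite mulr_ile1 ?exprn_ge0 ?expR_ge0 ?(ltW e0)//.
    by rewrite exprn_ile1 ?(ltW e0)// expR_le1 oppr_le0.
  by rewrite expR_le1 oppr_le0 expR_ge0.
Qed.

End Laguerre.


(** * Jacobi weights: finite moments and Pearson equation *)

Section Jacobi.
Variables al be : R.
Hypothesis al_gt : -1 < al.
Hypothesis be_gt : -1 < be.
Let s := al + 1.
Let t := be + 1.
Let w := w_jacobi al be.
Let I : set R := [set x | -1 < x < 1].
Let lo (n : nat) : R := -1 + expR (- n%:R).
Let hi (n : nat) : R := 1 - expR (- n%:R).

Let s_gt0 : 0 < s. Proof. by rewrite /s -(ltrBlDr) sub0r. Qed.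
Let t_gt0 : 0 < t. Proof. by rewrite /t -(ltrBlDr) sub0r. Qed.

Let openI : open I.
Proof.
rewrite (_ : I = [set x | -1 < x] `&` [set x | x < 1]).
  (* This [openI] is the stability of open sets under intersection, not the fact being proved. *)
  by apply: openI; [exact: open_gt | exact: open_lt].
by apply/seteqP; split=> [x /andP[]|x []] /= x1 x2; rewrite /I /= ?x1.
Qed.

Let expRN_le1 n : expR (- n%:R) <= 1 :> R.
Proof. by rewrite expR_le1 oppr_le0. Qed.

Let lohi n : lo n <= hi n.
Proof. by rewrite /lo /hi; have := expRN_le1 n; lra. Qed.

Let hi_inc m n : (m <= n)%N -> hi m <= hi n.
Proof. by move=> mn; rewrite lerD2l lerN2 ler_expR lerN2 ler_nat. Qed.

Let lo_dec m n : (m <= n)%N -> lo n <= lo m.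
Proof. by move=> mn; rewrite lerD2l ler_expR lerN2 ler_nat. Qed.

Let IE : I = \bigcup_n `[lo n, hi n].
Proof.
apply/seteqP; split=> x; last first.
  case=> n _ /=; rewrite in_itv/= /lo /hi.
  by have := expR_gt0 (- n%:R : R); move=> ? /andP[? ?]; apply/andP; split; lra.
move=> /andP[x1 x2]; have x0 : 0 < 1 - `|x|.
  by rewrite subr_gt0 ltr_norml x1.
have [n hn] := expR_nat_unbounded (1 - `|x|)^-1.
exists n => //=; rewrite in_itv/= /lo /hi.
have : expR (- n%:R) <= 1 - `|x|.
  by rewrite expRN invf_ple ?posrE ?expR_gt0.
have := ler_norm x; have := ler_norm (- x); rewrite normrN.
by move=> ? ? ?; apply/andP; split; lra.
Qed.

Lemma oitv_jacobi : oitv (-1)%:E 1%:E = I.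
Proof. by apply/seteqP; split=> x; rewrite /oitv/I/= !lte_fin. Qed.

Let I_p x : I x -> 0 < 1 + x.
Proof. by case/andP => ? _; lra. Qed.

Let I_m x : I x -> 0 < 1 - x.
Proof. by case/andP => _ ?; lra. Qed.

Let is_derive_m x r : I x ->
  is_derive x 1 (fun y : R => (1 - y) `^ r) (- (r * (1 - x) `^ (r - 1))).
Proof.
move=> Ix; have d : is_derive x 1 (fun y : R => 1 - y) (- 1).
  rewrite (_ : (fun y => _) = horner (1 - 'X)); last first.
    by apply/funext => y; rewrite !hornerE.
  apply: (is_derive_eq (is_derive_poly _ x)).
  by rewrite !poly.derivE !hornerE.
have dr : is_derive (1 - x) 1 (fun z : R => z `^ r) _ := is_derive1_powR r (I_m Ix).
have := @is_derive1_comp R (fun z => z `^ r) (fun y => 1 - y) x _ _ dr d.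
by rewrite mulrN1.
Qed.

Let is_derive_p x r : I x ->
  is_derive x 1 (fun y : R => (1 + y) `^ r) (r * (1 + x) `^ (r - 1)).
Proof.
move=> Ix; have d : is_derive x 1 (fun y : R => 1 + y) 1.
  rewrite (_ : (fun y => _) = horner (1 + 'X)); last first.
    by apply/funext => y; rewrite !hornerE.
  apply: (is_derive_eq (is_derive_poly _ x)).
  by rewrite !poly.derivE !hornerE.
have dr : is_derive (1 + x) 1 (fun z : R => z `^ r) _ := is_derive1_powR r (I_p Ix).
have := @is_derive1_comp R (fun z => z `^ r) (fun y => 1 + y) x _ _ dr d.
by rewrite mulr1.
Qed.

Let cm x r : I x -> {for x, continuous (fun y : R => (1 - y) `^ r)}.
Proof. by move=> Ix; exact: is_derive_continuous (is_derive_m r Ix). Qed.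

Let cp x r : I x -> {for x, continuous (fun y : R => (1 + y) `^ r)}.
Proof. by move=> Ix; exact: is_derive_continuous (is_derive_p r Ix). Qed.

Let cw x : I x -> {for x, continuous w}.
Proof. by move=> Ix; apply: cvgM; [exact: cm | exact: cp]. Qed.

(** Since [t - 1] is [be] and [s - 1] is [al], this carries the endpoint singularities of [w] at
    both ends while its primitive [Phi] stays bounded. *)
Let phi x := t * (1 + x) `^ (t - 1) + s * (1 - x) `^ (s - 1).
Let Phi x := (1 + x) `^ t - (1 - x) `^ s.

Let dphi x : I x -> is_derive x 1 Phi (phi x).
Proof.
move=> Ix.
apply: (is_derive_eq (is_deriveB (is_derive_p t Ix) (is_derive_m s Ix))).
by rewrite opprK.
Qed.

Let cphi x : I x -> {for x, continuous phi}.
Proof.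
move=> Ix; apply: cvgD; apply: cvgM.
- exact: cvg_cst.
- exact: cp.
- exact: cvg_cst.
- exact: cm.
Qed.

Let pm_le2 x r : I x -> 0 <= r -> (1 + x) `^ r <= 2 `^ r /\ (1 - x) `^ r <= 2 `^ r.
Proof.
by move=> /andP[x1 x2] r0; split; apply: powR_le2 => //; apply/andP; split; lra.
Qed.

Let iphi : mu.-integrable I (EFin \o phi).
Proof.
apply: (@integrable_bounded_primitive R I lo hi openI lohi lo_dec hi_inc IE
  phi Phi dphi cphi (2 `^ t + 2 `^ s)) => x Ix.
- by rewrite addr_ge0// mulr_ge0 ?powR_ge0// ltW.
- have [h1 _] := pm_le2 Ix (ltW t_gt0); have [_ h2] := pm_le2 Ix (ltW s_gt0).
  have h3 := powR_ge0 (1 + x) t; have h4 := powR_ge0 (1 - x) s.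
  by rewrite ler_norml /Phi; apply/andP; split; lra.
Qed.

Let pow_norm_le1 x k : I x -> `|x ^+ k| <= 1.
Proof.
by case/andP => x1 x2; rewrite normrX exprn_ile1// ler_norml !ltW.
Qed.

Let dom k : exists c, forall x, I x -> `|x ^+ k * w x| <= c * phi x.
Proof.
exists (2 `^ s / t + 2 `^ t / s) => x Ix.
have w0 : 0 <= w x by rewrite mulr_ge0 ?powR_ge0.
rewrite normrM (ger0_norm w0); apply: (@le_trans _ _ (w x)).
  by rewrite ler_piMl// pow_norm_le1.
have es : s - 1 = al by rewrite /s addrK.
have et : t - 1 = be by rewrite /t addrK.
rewrite /phi es et /w /w_jacobi.
have [_ h1] := pm_le2 Ix (ltW s_gt0); have [h2 _] := pm_le2 Ix (ltW t_gt0).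
rewrite [_ `^ s]powR_S ?I_m// es in h1; rewrite [_ `^ t]powR_S ?I_p// et in h2.
have A0 := powR_ge0 (1 - x) al; have B0 := powR_ge0 (1 + x) be.
have hs : 0 <= 2 `^ s / t by rewrite divr_ge0 ?powR_ge0// ltW.
have ht : 0 <= 2 `^ t / s by rewrite divr_ge0 ?powR_ge0// ltW.
have es' : 2 `^ s / t * (t * (1 + x) `^ be) = 2 `^ s * (1 + x) `^ be.
  by field; rewrite gt_eqF.
have et' : 2 `^ t / s * (s * (1 - x) `^ al) = 2 `^ t * (1 - x) `^ al.
  by field; rewrite gt_eqF.
rewrite mulrDl !mulrDr es' et' -/(powR _ _).
have p1 : 0 <= 2 `^ s / t * (s * (1 - x) `^ al).
  by apply: mulr_ge0 => //; apply: mulr_ge0; first exact: ltW.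
have p2 : 0 <= 2 `^ t / s * (t * (1 + x) `^ be).
  by apply: mulr_ge0 => //; apply: mulr_ge0; first exact: ltW.
have p3 : 0 <= 2 `^ s * (1 + x) `^ be by rewrite mulr_ge0 ?powR_ge0.
have p4 : 0 <= 2 `^ t * (1 - x) `^ al by rewrite mulr_ge0 ?powR_ge0.
(* On each half one factor of [w] has base at least 1, so raising its exponent by one bounds it by
   [2]^ s[or]2 [^ t]; the other factor is a term of [phi]. *)
have [x0|x0] := leP x 0.
  have h : (1 - x) `^ al <= 2 `^ s.
    by apply: le_trans h1; rewrite ler_peMl// lerDl oppr_ge0.
  have := ler_wpM2r B0 h; lra.
have h : (1 + x) `^ be <= 2 `^ t.
  by apply: le_trans h2; rewrite ler_peMl// lerDl ltW.
have := ler_wpM2r A0 h; rewrite [X in X <= _]mulrC; lra.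
Qed.

Lemma moments_finite_jacobi : moments_finite (oitv (-1)%:E 1%:E) w.
Proof. by rewrite oitv_jacobi; exact: (moments_dominated openI cw iphi dom). Qed.

Let I_lohi n : I (lo n) /\ I (hi n).
Proof.
have h1 := expR_gt0 (- n%:R : R); have h2 := expRN_le1 n.
rewrite /I /lo /hi /=; split; apply/andP; split; lra.
Qed.

Lemma pearson_jacobi :
  pearson (polyRC (1 - 'X^2))
    (polyRC (t%:P * (1 - 'X) - s%:P * (1 + 'X)))
    (weight_fun (oitv (-1)%:E 1%:E) w).
Proof.
have hm := moments_finite_jacobi; rewrite oitv_jacobi in hm *.
have uw x : I x -> (1 - 'X^2).[x] * w x = (1 - x) `^ s * (1 + x) `^ t.
  move=> Ix; rewrite !hornerE /= /w /w_jacobi.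
  rewrite [_ `^ s]powR_S ?I_m// [_ `^ t]powR_S ?I_p//.
  have es : s - 1 = al by rewrite /s addrK.
  have et : t - 1 = be by rewrite /t addrK.
  by rewrite es et; ring.
apply: (pearson_weight openI lohi lo_dec hi_inc IE hm cw) => [x Ix|k|k].
- have dw : is_derive x 1 w _ := is_deriveM (is_derive_m al Ix) (is_derive_p be Ix).
  apply: (is_derive_eq (is_deriveM (is_derive_poly (1 - 'X^2) x) dw)).
  rewrite /GRing.scale/= !poly.derivE !hornerE /= /w /w_jacobi.
  rewrite [(1 - x) `^ al]powR_S ?I_m// [(1 + x) `^ be]powR_S ?I_p// /s /t.
  ring.
- apply: (@cvg_geometric_bound _ _ (2 `^ t) (expR (- s)) (expRN_01 s_gt0)) => n.
  have [_ Ih] := I_lohi n; rewrite uw// normrM.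
  rewrite -powR_expRn (_ : expR (- n%:R) = 1 - hi n); last by rewrite /hi subKr.
  have [h _] := pm_le2 Ih (ltW t_gt0).
  rewrite [X in _ * X]ger0_norm ?mulr_ge0 ?powR_ge0//.
  apply: (le_trans (ler_wpM2r _ (pow_norm_le1 k Ih))).
    by rewrite mulr_ge0 ?powR_ge0.
  by rewrite mul1r mulrC ler_wpM2r ?powR_ge0.
- apply: (@cvg_geometric_bound _ _ (2 `^ s) (expR (- t)) (expRN_01 t_gt0)) => n.
  have [Ih _] := I_lohi n; rewrite uw// normrM.
  rewrite -powR_expRn (_ : expR (- n%:R) = 1 + lo n); last by rewrite /lo; ring.
  have [_ h] := pm_le2 Ih (ltW s_gt0).
  rewrite [X in _ * X]ger0_norm ?mulr_ge0 ?powR_ge0//.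
  apply: (le_trans (ler_wpM2r _ (pow_norm_le1 k Ih))).
    by rewrite mulr_ge0 ?powR_ge0.
  by rewrite mul1r ler_wpM2r ?powR_ge0.
Qed.

End Jacobi.

End ClassicalWeights.

(** * Darboux transformations of direct sums of scalar weights *)

Section Main.
Variable R : realType.
Local Notation C := (R[i]).
Local Notation mu := (@lebesgue_measure R).
Local Notation measR := (@measurable _ (measurableTypeR R)).
Local Notation polyRC := (map_poly (@RtoC R)).
Local Notation lift := (map_mx polyC).

Lemma measurable_oitv c d : measR (@oitv R c d).
Proof.
apply: is_interval_measurable => x y; rewrite /oitv /= => /andP[cx _] /andP[_ yd] z.
move=> /andP[xz zy]; apply/andP; split.
  by apply: lt_le_trans cx _; rewrite lee_fin.
by apply: le_lt_trans yd; rewrite lee_fin.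
Qed.

Lemma measure_oitv_neq0 c d : (c < d)%E -> mu (@oitv R c d) != 0%E.
Proof.
move=> cd.
have [a [b [ab sub]]] : exists a b : R, a < b /\ `]a, b[%classic `<=` oitv c d.
  move: c d cd => [c||] [d||] //= cd.
  - by exists c, d; split=> // x; rewrite /oitv/= in_itv/= !lte_fin.
  - exists c, (c + 1); split; first by rewrite ltrDl.
    by move=> x; rewrite /oitv/= in_itv/= lte_fin ltry andbT => /andP[].
  - exists (d - 1), d; split; first by rewrite ltrBlDr ltrDl.
    by move=> x; rewrite /oitv/= in_itv/= lte_fin ltNyr => /andP[].
  - by exists 0, 1; split=> // x; rewrite /oitv/= ltNyr ltry.
rewrite gt_eqF//; apply: (@lt_le_trans _ _ (mu `]a, b[%classic)).
  by rewrite lebesgue_measure_itv/= lte_fin ab -EFinD lte_fin subr_gt0.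
apply: le_measure => //; rewrite inE //; exact: measurable_oitv.
Qed.

Lemma scalar_weight_moments c d (w : R -> R) : scalar_weight c d w ->
  moments_finite (oitv c d) w.
Proof.
case=> _ _ _ h; split=> [|k]; first exact: measurable_oitv.
have := h k 0 0; apply: eq_integrable; first exact: measurable_oitv.
by move=> x _; rewrite mxE eqxx mulr1n.
Qed.

Lemma scalar_weight_pos c d (w : R -> R) : scalar_weight c d w ->
  pos_fun (weight_fun (oitv c d) w).
Proof.
move=> hw; have [cd _ wpos _] := hw.
apply: weight_fun_pos; [exact: scalar_weight_moments| |exact: measure_oitv_neq0].
move: wpos; apply: (@filterS _ _ (ae_filter_ringOfSetsType mu)) => x h Ix.
have [_ /(_ 1)] := h Ix.
rewrite mul1mx trmx1 mulmx1 mxE eqxx mulr1n; apply.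
by apply/eqP => /matrixP/(_ 0 0) /eqP; rewrite !mxE eqxx oner_eq0.
Qed.

Lemma positive_weight_pos c d (w : R -> R) : (c < d)%E ->
  moments_finite (oitv c d) w -> (forall x, oitv c d x -> 0 < w x) ->
  pos_fun (weight_fun (oitv c d) w).
Proof.
move=> cd hw wpos; apply: weight_fun_pos => //; last exact: measure_oitv_neq0.
exact: aeW.
Qed.

(** The real form of [wronskian_root]: at a simple root of [u] the exponents of two dependent
    weights differ by an integer. *)
Lemma pearson_root I (w1 w2 : R -> R) (u u1 tau1 tau2 delta : {poly R})
    (f g : {poly C}) (a : R) :
  pos_fun (weight_fun I w1) -> f != 0 -> g != 0 ->
  pearson (polyRC u) (polyRC tau1) (weight_fun I w1) ->
  pearson (polyRC u) (polyRC tau2) (weight_fun I w2) ->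
  (forall q, weight_fun I w1 (f * q) = weight_fun I w2 (g * q)) ->
  tau1 - tau2 = delta -> u = ('X - a%:P) * u1 ->
  exists z : int, delta.[a] = u1.[a] * z%:~R.
Proof.
move=> pos1 f0 g0 p1 p2 h <- uE.
have := pearson_wronskian pos1 p1 p2 h; rewrite uE -rmorphB rmorphM /= => hw.
have [|z hz] := @wronskian_root _ f g (polyRC u1) (polyRC (tau1 - tau2))
  (RtoC a) f0 g0.
  by rewrite hw rmorphB /= map_polyX map_polyC.
exists z; have : RtoC (tau1 - tau2).[a] = RtoC (u1.[a] * z%:~R).
  by rewrite rmorphM rmorph_int -!horner_map.
by move/(congr1 (@complex.Re R)).
Qed.

(** * The nilpotent matrix A, the factor T and the reduction to algebra *)

Section Structure.
Variables (N : nat) (a : nat -> R).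
Local Notation mpoly := 'M[{poly C}]_N.
Local Notation A := (Amx N a).

Lemma sum_Emx_eq0 m n (c : nat -> R) (r t : nat -> nat) (i j : 'I_N) :
  (forall k, (m <= k)%N -> (i.+1 == r k) && (j.+1 == t k) = false) ->
  (\sum_(m <= k < n) c k *: Emx R N (r k) (t k)) i j = 0.
Proof.
move=> h; rewrite summxE big_nat big1// => k /andP[mk _].
by rewrite !mxE h// mulr0.
Qed.

(** Indices start at 0 here, so odd [i] means an even row in the usual numbering; both kinds of
    matrix units in [A] lie in odd rows and even columns there, whence also [A *m A = 0]. *)
Lemma Amx_odd_row (i j : 'I_N) : odd i -> A i j = 0.
Proof.
by move=> oi; rewrite mxE !sum_Emx_eq0 ?addr0// => k k1; apply/negbTE/negP; lia.
Qed.

Lemma Amx_even_col (i j : 'I_N) : ~~ odd j -> A i j = 0.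
Proof.
by move=> oj; rewrite mxE !sum_Emx_eq0 ?addr0// => k k1; apply/negbTE/negP; lia.
Qed.

Lemma Amx_sqr0 : A *m A = 0.
Proof.
apply/matrixP => i j; rewrite !mxE big1// => k _.
have [ok|ek] := boolP (odd k); first by rewrite (Amx_odd_row _ ok) mulr0.
by rewrite (Amx_even_col _ ek) mul0r.
Qed.

Lemma Amx_01 (i1 i0 : 'I_N) : i1 = 0%N :> nat -> i0 = 1%N :> nat -> A i1 i0 = a 1%N.
Proof.
move=> e1 e0; have N2 : (1 < N)%N by rewrite -e0 ltn_ord.
rewrite mxE big_ltn ?sum_Emx_eq0 ?addr0; last first.
- by lia.
- by move=> k k1; apply/negbTE/negP; lia.
rewrite mxE sum_Emx_eq0 => [|k k1]; last by apply/negbTE/negP; lia.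
by rewrite !mxE e1 e0 /= mulr1 addr0.
Qed.

Definition Apoly : mpoly := map_mx polyC (map_mx (@RtoC R) A).
Definition Tpoly : mpoly := 1%:M + 'X *: Apoly.
Definition Tinv : mpoly := 1%:M - 'X *: Apoly.

Lemma Tpoly_inv : Tpoly *m Tinv = 1%:M.
Proof.
have A0 : Apoly *m Apoly = 0 by rewrite -!map_mxM Amx_sqr0 !map_mx0.
rewrite mulmxDl mul1mx mulmxBr mulmx1 -!scalemxAl -!scalemxAr A0.
by rewrite !scaler0 subr0 subrK.
Qed.

Lemma evalmp_Tpoly x : evalmp Tpoly x = map_mx (@RtoC R) (Tmx N a x).
Proof.
rewrite /Tpoly /Apoly /Tmx; move: A => M; apply/matrixP => i j.
rewrite !mxE hornerD hornerM hornerX hornerC hornerMn hornerC.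
by rewrite rmorphD rmorphM rmorphMn rmorph1.
Qed.

Lemma row_Tinv (i : 'I_N) : odd i -> row i Tinv = delta_mx 0 i.
Proof.
move=> oi; have h k : A i k = 0 by exact: Amx_odd_row.
rewrite /Tinv /Apoly; move: A h => M h; apply/rowP => k.
by rewrite !mxE h !rmorph0 mulr0 subr0 eqxx eq_sym.
Qed.

Lemma Tpoly_diag (i : 'I_N) : odd i -> Tpoly i i = 1.
Proof.
move=> oi; have h k : A i k = 0 by exact: Amx_odd_row.
rewrite /Tpoly /Apoly; move: A h => M h.
by rewrite !mxE h !rmorph0 mulr0 addr0 eqxx.
Qed.

Lemma Tpoly_01 (i1 i0 : 'I_N) : i1 = 0%N :> nat -> i0 = 1%N :> nat ->
  Tpoly i1 i0 = (RtoC (a 1%N))%:P * 'X.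
Proof.
move=> e1 e0; have h := Amx_01 e1 e0.
rewrite /Tpoly /Apoly; move: A h => M h; rewrite !mxE h.
by rewrite -val_eqE /= e1 e0 /= add0r mulrC.
Qed.


Lemma row_lift_mul (B : 'M[C]_N) (P : mpoly) i :
  row i (lift B *m P) = lift (row i B) *m P.
Proof. by rewrite row_mul map_row. Qed.

(** The expansion of [P n . D] starts at index [n - l], so every polynomial in it has index above
    [m]. *)
Lemma fourier_orth (L : 'I_N -> {scalar {poly C}}) (P : nat -> mpoly) D :
  (forall n m i j, n <> m -> rform L (row i (P n)) (row j (P m)) = 0) ->
  in_fourierR P D ->
  exists l, forall n m i j, (m + l < n)%N ->
    rform L (row i (dact D (P n))) (row j (P m)) = 0.
Proof.
move=> orth [l [k [B hB]]]; exists l => n m i j mln.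
rewrite -[dact D (P n)]/(dop_act D (P n)) hB linear_sum /=.
rewrite (big_morph (fun r => rform L r (row j (P m))) (id1 := 0) (op1 := +%R)).
- apply: big1 => h _; rewrite row_lift_mul rform_lift_l big1// => c _.
  case: leqP => lnh; last by rewrite row0 rform0l mulr0.
  by rewrite orth ?mulr0//; lia.
- by move=> *; rewrite rformDl.
- exact: rform0l.
Qed.

Lemma torat_eq (A1 A2 F : mpoly) : torat F \in unitmx ->
  torat A1 = torat A2 *m invmx (torat F) -> A1 *m F = A2.
Proof.
move=> uF h; have : torat A1 *m torat F = torat A2 by rewrite h mulmxKV.
rewrite -map_mxM => /matrixP e; apply/matrixP => i j.
apply/eqP; rewrite -tofrac_eq; apply/eqP; move: (e i j).
by rewrite [X in X = _]mxE [X in _ = X]mxE.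
Qed.

Lemma torat_det (F : mpoly) : torat F \in unitmx -> \det F != 0.
Proof.
rewrite unitmxE unitfE; apply: contraNneq => h.
by rewrite /torat det_map_mx h rmorph0.
Qed.

(** Passes from analysis to algebra: integrals become moment functionals, and the Darboux identity
    is cleared of denominators. *)
Lemma not_darboux c d (w : 'I_N -> R -> R) (u : {poly C}) (tau : 'I_N -> {poly C}) :
  (2 <= N)%N -> (forall s : nat, (1 <= s <= N.-1)%N -> a s != 0) ->
  (forall i, moments_finite (oitv c d) (w i)) ->
  (forall i, pos_fun (weight_fun (oitv c d) (w i))) ->
  u != 0 -> (forall i, pearson u (tau i) (weight_fun (oitv c d) (w i))) ->
  (forall i j, i != j ->
    indep_fun (weight_fun (oitv c d) (w i)) (weight_fun (oitv c d) (w j))) ->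
  ~ darboux_of_scalar_sum c d (W_of a w).
Proof.
move=> N2 ha hw posM u0 hpear hindep [c1 [d1 [w1 [hw1 [P [Q]]]]]].
case=> -[monicP ipP] [monicQ ipQ] [D [Dt [F [Ft [Cn [Ctn]]]]]].
case=> -[fD _ uF _] [[n0 hC] _ CQF _].
pose L := weight_funs (oitv c1 d1) w1; pose M := weight_funs (oitv c d) w.
(* [i0] is the second index and [i1] the first, so the entry of [T] in row [i1] and column [i0] is
   [a_1 x]. *)
pose i0 : 'I_N := Ordinal N2; pose i1 : 'I_N := Ordinal (ltnW N2).
have orthP n m i j : n <> m -> rform L (row i (P n)) (row j (P m)) = 0.
  move=> nm; rewrite -(mulmx1 (P n)) -(mulmx1 (P m)).
  apply: (@ip_zero_rform _ _ c1 d1 (direct_sum w1) (fun=> 1%:M)).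
  - move=> x; apply/matrixP => r s; rewrite !mxE.
    by rewrite hornerMn hornerC rmorphMn rmorph1.
  - by move=> x; rewrite mul1mx trmx1 mulmx1.
  - by move=> k; exact: scalar_weight_moments.
  - exact: ipP.
have orthQ n m i j : n <> m ->
    rform M (row i (Q n *m Tpoly)) (row j (Q m *m Tpoly)) = 0.
  move=> nm; apply: (@ip_zero_rform _ _ c d (W_of a w) (Tmx N a)) => //.
  - exact: evalmp_Tpoly.
  - exact: ipQ.
have [l hl] := fourier_orth orthP fD.
apply: (@diagonal_darboux_absurd _ N M L Tpoly Tinv F P Q D Cn u tau i0 i1 (RtoC (a 1%N))
  l n0  posM) => //.
- by move=> i; exact: scalar_weight_pos.
- exact: Tpoly_inv.
- exact: row_Tinv.
- exact: Tpoly_diag.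
- exact: Tpoly_01.
- rewrite -(rmorph0 (@RtoC R)) (inj_eq (@complexI R)); apply: ha; lia.
- exact: torat_det.
- by move=> n; apply: (torat_eq uF); exact: CQF.
Qed.

End Structure.
End Main.

(** * Independence of the weights within each classical family *)

Section Cases.
Variable R : realType.
Variables (N : nat) (a : nat -> R).
Local Notation polyRC := (map_poly (@RtoC R)).
Hypothesis N2 : (2 <= N)%N.
Hypothesis ha : forall s : nat, (1 <= s <= N.-1)%N -> a s != 0.

Lemma polyRC_neq0 (p : {poly R}) : p != 0 -> polyRC p != 0.
Proof. by rewrite map_poly_eq0. Qed.

Lemma not_darboux_hermite (b : 'I_N -> R) : (forall i j, i != j -> b i != b j) ->
  ~ darboux_of_scalar_sum -oo%E +oo%E (W_H a b).
Proof.
move=> hb.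
have posM i : pos_fun (weight_fun (oitv -oo%E +oo%E) (w_hermite (b i))).
  apply: positive_weight_pos => //; first exact: moments_finite_hermite.
  by move=> x _; exact: expR_gt0.
apply: (not_darboux N2 ha (fun i => moments_finite_hermite (b i)) posM
  (polyRC_neq0 (oner_neq0 _)) (fun i => pearson_hermite (b i))) => i j ij.
apply: indep_funI => // f g f0 g0 hfg.
have := pearson_wronskian (posM i) (pearson_hermite (b i))
  (pearson_hermite (b j)) hfg.
rewrite -rmorphB rmorph1 mul1r /=.
(* The difference of the two [tau] is constant, so the Wronskian identity forces [b i = b j]. *)
have -> : - 2%:P * 'X + (2 * b i)%:P - (- 2%:P * 'X + (2 * b j)%:P) =
    (2 * (b i - b j))%:P :> {poly R}.
  by rewrite mulrBr polyCB; ring.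
rewrite map_polyC => /(wronskian_const f0 g0)/(congr1 (@complex.Re R)) /= /eqP.
by rewrite mulf_eq0 pnatr_eq0 /= subr_eq0 (negbTE (hb _ _ ij)).
Qed.

Lemma not_darboux_laguerre (al : 'I_N -> R) : (forall i, -1 < al i) ->
  (forall i j, i != j -> forall z : int, al i - al j != z%:~R) ->
  ~ darboux_of_scalar_sum 0%:E +oo%E (W_L a al).
Proof.
move=> hal hb.
have posM i : pos_fun (weight_fun (oitv 0%:E +oo%E) (w_laguerre (al i))).
  apply: positive_weight_pos; first exact: ltry.
    exact: (moments_finite_laguerre (hal i)).
  move=> x /andP[]; rewrite lte_fin => x0 _.
  by rewrite mulr_gt0 ?expR_gt0 ?powR_gt0.
have hp i := pearson_laguerre (hal i).
apply: (not_darboux N2 ha (fun i => moments_finite_laguerre (hal i)) posM _ hp).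
  by rewrite polyRC_neq0// polyX_eq0.
move=> i j ij; apply: indep_funI => // f g f0 g0 hfg.
(* At the root 0 of [u] the cofactor is 1, which makes [al i - al j] an integer. *)
have [||z hz] := @pearson_root R _ _ _ 'X 1 _ _ (al i - al j)%:P f g 0
  (posM i) f0 g0 (hp i) (hp j) hfg.
- by rewrite !polyCD polyCN; ring.
- by rewrite subr0 mulr1.
- by move: (hb i j ij z); rewrite hornerC in hz; rewrite hz hornerC mul1r eqxx.
Qed.

Lemma not_darboux_jacobi (al be : 'I_N -> R) :
  (forall i, -1 < al i) -> (forall i, -1 < be i) ->
  (forall i j, i != j ->
     (forall z : int, al i - al j != z%:~R) \/
     (forall z : int, be i - be j != z%:~R)) ->
  ~ darboux_of_scalar_sum (-1)%:E 1%:E (W_J a al be).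
Proof.
move=> hal hbe hb.
have posM i : pos_fun (weight_fun (oitv (-1)%:E 1%:E) (w_jacobi (al i) (be i))).
  apply: positive_weight_pos; first by rewrite lte_fin; lra.
    exact: (moments_finite_jacobi (hal i) (hbe i)).
  move=> x /andP[]; rewrite !lte_fin => x1 x2.
  by rewrite mulr_gt0 ?powR_gt0//; lra.
have hp i := pearson_jacobi (hal i) (hbe i).
apply: (not_darboux N2 ha (fun i => moments_finite_jacobi (hal i) (hbe i))
  posM _ hp).
  rewrite polyRC_neq0//; apply/eqP => /(congr1 (fun p => p.[0])).
  by rewrite !hornerE /= => /eqP; rewrite ?expr0n/= ?subr0 oner_eq0.
move=> i j ij; apply: indep_funI => // f g f0 g0 hfg.
pose delta : {poly R} :=
  (be i - be j)%:P * (1 - 'X) - (al i - al j)%:P * (1 + 'X).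
(* At 1, [delta] is [-2 (al i - al j)] and the cofactor of the root is -2; at -1 they are
   [2 (be i - be j)] and 2. The endpoint with non-integer difference is chosen. *)
have [h|h] := hb _ _ ij.
  have [||z hz] := @pearson_root R _ _ _ (1 - 'X^2) (- (1 + 'X)) _ _ delta f g 1
    (posM i) f0 g0 (hp i) (hp j) hfg.
  - by rewrite /delta !polyCD !polyCN; ring.
  - by rewrite polyC1; ring.
  - move: (h z); suff -> : al i - al j = z%:~R by rewrite eqxx.
    by move: hz; rewrite /delta !hornerE; lra.
have [||z hz] := @pearson_root R _ _ _ (1 - 'X^2) (1 - 'X) _ _ delta f g (-1)
  (posM i) f0 g0 (hp i) (hp j) hfg.
- by rewrite /delta !polyCD !polyCN; ring.
- by rewrite polyCN polyC1; ring.
- move: (h z); suff -> : be i - be j = z%:~R by rewrite eqxx.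
  by move: hz; rewrite /delta !hornerE; lra.
Qed.

End Cases.

Unset Implicit Arguments.
Set Strict Implicit.
Local Close Scope classical_set_scope.

Theorem theorem3p11 (R : realType) (N : nat) (a : nat -> R) :
  (2 <= N)%N ->
  (forall s : nat, (1 <= s <= N.-1)%N -> a s != 0) ->
  [/\ (* Hermite type *)
      (forall b : 'I_N -> R,
         (forall i j, i != j -> b i != b j) ->
         ~ darboux_of_scalar_sum -oo%E +oo%E (W_H a b)),
      (* Laguerre type *)
      (forall al : 'I_N -> R,
         (forall i, -1 < al i) ->
         (forall i j, i != j -> forall z : int, al i - al j != z%:~R) ->
         ~ darboux_of_scalar_sum 0%:E +oo%E (W_L a al)) &
      (* Jacobi type *)
      (forall al be : 'I_N -> R,
         (forall i, -1 < al i) -> (forall i, -1 < be i) ->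
         (forall i j, i != j ->
            (forall z : int, al i - al j != z%:~R) \/
            (forall z : int, be i - be j != z%:~R)) ->
         (forall i1 j : 'I_N, nat_of_ord i1 = 0%N ->
            al i1 + be i1 = al j + be j + 1 + (-1) ^+ (j.+1)) ->
         ~ darboux_of_scalar_sum (-1)%:E 1%:E (W_J a al be))].
Proof.
move=> N2 ha; split.
- by move=> b; exact: not_darboux_hermite.
- by move=> al; exact: not_darboux_laguerre.
- by move=> al be hal hbe hb _; exact: not_darboux_jacobi.
Qed.
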